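(* Let $d \geq 2$, $k \in \mathbb{N}$ and $L>1$ be constants. For any $\epsilon > 0$, the query complexity of finding an $\epsilon$-approximate Brouwer fixed point of an $L$-Lipschitz function $F:[0,1]^d\to[0,1]^d$ with at most $k$ rounds of queries is $\Theta\bigl((1/\epsilon)^{\frac{d^{k+1} - d^k}{d^k - 1}}\bigr)$, both for deterministic and for randomized algorithms.
   Context: $F$ is $L$-Lipschitz if $\|F(\vec{x})-F(\vec{y})\|_\infty \le L\|\vec{x}-\vec{y}\|_\infty$ for all $\vec{x},\vec{y}\in[0,1]^d$. An $\epsilon$-approximate fixed point is a point $\vec{x}^*\in[0,1]^d$ with $\|F(\vec{x}^* )-\vec{x}^*\|_\infty \le \epsilon$. The algorithm accesses $F$ through an oracle returning $F(\vec{x})$ on a query $\vec{x}$. In a $k$-round algorithm, in each round the algorithm submits a set of queries depending only on answers from earlier rounds (and its random coins, if randomized), then receives all answers; after round $k$ it must output a solution. Deterministic query complexity: worst-case total number of queries to always succeed; randomized query complexity: worst-case expected number of queries of an algorithm succeeding with probability at least $2/3$ on every input. Asymptotics are as $\epsilon\to 0$. *)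

(* Defs.v *)
(* MathComp / MathComp-Analysis *)
From HB Require Import structures.
From mathcomp Require Import all_boot all_order all_algebra.
From mathcomp Require Import all_classical all_reals all_analysis.

Set Implicit Arguments.
Unset Strict Implicit.
Unset Printing Implicit Defensive.

Import Order.TTheory GRing.Theory Num.Theory.
Import numFieldNormedType.Exports.

Local Open Scope classical_set_scope.
Local Open Scope ring_scope.

Definition cube (R : realType) (d : nat) : set 'rV[R]_d :=
  [set x | forall i, 0 <= x ord0 i <= 1].
Arguments cube : clear implicits.

(* The norm of ['rV[R]_d] is the sup norm, see [mx_normrE]. *)
Definition lipschitz_maps (R : realType) (d : nat) (L : R) :
    set (cube R d -> cube R d) :=
  [set F | forall x y, `|val (F x) - val (F y)| <= L * `|val x - val y|].

Definition approx_fixed_point (R : realType) (d : nat) (eps : R)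
    (F : cube R d -> cube R d) : set (cube R d) :=
  [set x | `|val (F x) - val x| <= eps].

(* Deterministic algorithm with [k] rounds, querying an oracle [X -> X] and
   outputting a point of [X]. [Round qs next] submits the queries [qs] and
   continues with [next ans], where [ans] lists the answers in the order of
   [qs]. A round may be empty, so fewer than [k] rounds are allowed. *)
Inductive algorithm (X : Type) : nat -> Type :=
| Output of X : algorithm X 0
| Round k of seq X & (seq X -> algorithm X k) : algorithm X k.+1.

Fixpoint output X k (F : X -> X) (A : algorithm X k) : X :=
  match A with
  | Output x => x
  | Round _ qs next => output F (next (map F qs))
  end.

Fixpoint query_count X k (F : X -> X) (A : algorithm X k) : nat :=
  match A with
  | Output _ => 0%N
  | Round _ qs next => (size qs + query_count F (next (map F qs)))%N
  end.

Definition det_solves (R : realType) (d k : nat) (L eps : R)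
    (A : algorithm (cube R d) k) : Prop :=
  forall F, lipschitz_maps L F -> approx_fixed_point eps F (output F A).

Definition det_cost (R : realType) (d k : nat) (L : R)
    (A : algorithm (cube R d) k) : \bar R :=
  ereal_sup [set (query_count F A)%:R%:E | F in @lipschitz_maps R d L].

Definition det_query_complexity (R : realType) (d k : nat) (L eps : R) : \bar R :=
  ereal_inf [set c | exists2 A : algorithm (cube R d) k,
    det_solves L eps A & c = det_cost L A].

(* A randomized algorithm is a deterministic one chosen by random coins, drawn
   from an arbitrary probability space. *)
Record rand_algorithm (R : realType) (X : Type) (k : nat) := RandAlgorithm {
  coin_display : measure_display;
  coins : measurableType coin_display;
  coin_law : probability coins R;
  strategy : coins -> algorithm X k }.

(* The measurability requirements only ensure that the success probability and
   the expected number of queries are meaningful. *)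
Definition rand_solves (R : realType) (d k : nat) (L eps : R)
    (A : rand_algorithm R (cube R d) k) : Prop :=
  forall F, lipschitz_maps L F ->
    let success :=
      [set w | approx_fixed_point eps F (output F (strategy (r := A) w))] in
    [/\ measurable success,
        measurable_fun setT
          (fun w => (query_count F (strategy (r := A) w))%:R : R) &
        ((2 / 3)%:E <= coin_law A success)%E].

Definition rand_cost (R : realType) (d k : nat) (L : R)
    (A : rand_algorithm R (cube R d) k) : \bar R :=
  ereal_sup
    [set ('E_(coin_law A)[fun w => (query_count F (strategy (r := A) w))%:R])%E
    | F in @lipschitz_maps R d L].

Definition rand_query_complexity (R : realType) (d k : nat) (L eps : R) : \bar R :=
  ereal_inf [set c | exists2 A : rand_algorithm R (cube R d) k,
    rand_solves L eps A & c = rand_cost L A].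

(* [fine] sends infinite values to 0, hence the separate finiteness clause. *)
Definition complexity_Theta (R : realType) (Q : R -> \bar R) (g : R -> R) : Prop :=
  (forall eps, 0 < eps -> Q eps \is a fin_num) /\
  (fine \o Q : R -> R^o) =Theta_(0^'+) (g : R -> R^o).

(* Main.v *)
(* Upper bound. Label a grid point x by the signs of the coordinates of
   F x - x. Mod 2, the degree of this labelling over a box is a sum of
   contributions of the unit cells, in which a nonzero contribution forces every
   coordinate of F x - x to change sign, and also a sum over the boundary of the
   box. The degree of the whole cube is 1. In each round the boxes of the next
   size in the current box have their boundaries queried, which determines
   their degrees, and one of odd degree becomes the current box.

   Lower bound (Yao's principle). A monotone path from the origin carries a map
   whose approximate fixed points are all close to the end of the path, and
   whose values away from the path do not depend on it. The path visits random
   points p_1, ..., p_(k+1) in random nested boxes. A query made before p_t is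
   known meets the path beyond p_t with probability O(l_t / l_(t-1) ^ d), where
   l_t is the side of the t-th box, so that with few queries each round only
   reveals one more point.

   In both bounds the sides of the boxes make l_(t-1) ^ d / l_t independent of
   the round t. *)
Require Import Defs.
From mathcomp Require Import all_boot all_order all_algebra.
From mathcomp Require Import all_classical all_reals all_analysis.
From mathcomp Require Import zify ring lra.
Import Order.TTheory GRing.Theory Num.Theory.
Import numFieldNormedType.Exports.
Set Implicit Arguments.
Unset Strict Implicit.
Unset Printing Implicit Defensive.
Local Open Scope ring_scope.

(** * Degree of a labelling of the grid *)

(** The same quantity governs both bounds. Cutting a box of side a into boxes of side b costs about
    a ^ d / b queries, the number of grid points on the walls; a monotone path inside one box of
    side b meets about b of the a ^ d cells in which it could lie. Balancing the rounds gives d e_t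
    = alpha + e_(t+1) with e_0 = 1 and e_k = 0, and the exponent of the theorem is the only alpha
    for which this has a solution. Mod 2 no orientations are needed, and Stokes' formula for the
    degree is a telescoping sum.

    In the lower bound L may be arbitrarily close to 1. The map is therefore the identity plus a
    small multiple [sigma] of a Lipschitz field of size w, and w is taken of order eps / [sigma], so
    that the tube around the path still has radius of order eps. The output acts as one more query,
    hence k + 1 random points against k rounds. *)

Lemma addF2 (a : 'F_2) : a + a = 0.
Proof. by apply/val_inj; case: a => [[|[|]]]. Qed.

(** The terms of (i, j) and (j, i) cancel mod 2; [enum_rank] tells the two orders apart. *)
Lemma sum_sym_F2 (I : finType) (A : {set I}) (H : I -> I -> 'F_2) :
  (forall i j, H i j = H j i) -> \sum_(i in A) \sum_(j in A :\ i) H i j = 0.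
Proof.
move=> Hsym; pose r (i : I) := enum_rank i.
have E i : \sum_(j in A :\ i) H i j =
    \sum_(j in A | (r i < r j)%N) H i j + \sum_(j in A | (r j < r i)%N) H i j.
  rewrite (bigID (fun j => (r i < r j)%N)) /=; congr (_ + _); apply: eq_bigl => j.
    rewrite !inE; case: (eqVneq j i) => [->|_] /=; first by rewrite ltnn andbF.
    by [].
  rewrite !inE -leqNgt leq_eqVlt; case: (eqVneq j i) => [->|ne] /=.
    by rewrite ltnn andbF.
  have -> : (r j == r i :> nat) = false; last by [].
  by apply/negbTE; apply: contra ne => /eqP/val_inj/enum_rank_inj ->.
rewrite (eq_bigr _ (fun i _ => E i)) big_split /=.
rewrite [X in _ + X](exchange_big_dep (mem A)) /=; last by move=> i j _ /andP[].
rewrite -[RHS](addF2 (\sum_(i in A) \sum_(j in A | (r i < r j)%N) H i j)); congr (_ + _).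
apply: eq_bigr => i iA; apply: eq_big => [j|j _]; last exact: Hsym.
by rewrite iA.
Qed.

Section Parity.
Variable d : nat.
Notation pt := ('I_d -> nat).
Implicit Types (x y : pt) (A : {set 'I_d}) (F : 'I_d -> pt -> 'F_2) (s : seq 'I_d).

Definition step x (j : 'I_d) : pt := fun i => (x i + (i == j))%N.

Lemma stepC x i j : step (step x i) j = step (step x j) i.
Proof. by apply/funext => k; rewrite /step addnAC. Qed.

(* The value on the cell based at [x] and spanned by the directions [A] of the
   cup product of the mod 2 coboundaries of [F j], [j <- s]. As [dF] is closed,
   this product is the coboundary of [F j * (product of the others)], which is
   the recursive definition used here. *)
Fixpoint cup F A x s : 'F_2 :=
  if s is j :: s' then
    \sum_(i in A) (F j (step x i) * cup F (A :\ i) (step x i) s' +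
                   F j x * cup F (A :\ i) x s')
  else 1.

(** The square of the coboundary is zero: each face of codimension two arises from both orders of
    removing its two directions, with equal contributions. *)
Lemma cup_closed F A x s :
  \sum_(i in A) (cup F (A :\ i) (step x i) s + cup F (A :\ i) x s) = 0.
Proof.
case: s => [|k s] /=; first by rewrite big1 // => i _; rewrite addF2.
pose G i j y := F k y * cup F (A :\ i :\ j) y s.
pose H i j := G i j (step (step x i) j) + G i j (step x i) + (G i j (step x j) + G i j x).
rewrite -[RHS](@sum_sym_F2 _ A H) => [|i j].
  by apply: eq_bigr => i _; rewrite -big_split.
have Gs y : G i j y = G j i y.
  by rewrite /G; congr (_ * cup _ _ _ _); apply/setP => z; rewrite !inE; do !bool_congr.
by rewrite /H !Gs stepC -!addrA; congr (_ + _); rewrite addrCA.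
Qed.

Definition in_cell A x y := forall i, (x i <= y i <= x i + (i \in A))%N.

Lemma in_cell_refl A x : in_cell A x x.
Proof. by move=> i; rewrite leqnn leq_addr. Qed.

Lemma in_cell_sub A x i y : i \in A -> in_cell (A :\ i) x y -> in_cell A x y.
Proof.
move=> iA H j; move: (H j); rewrite !inE; case: eqVneq => [->|] //=.
by rewrite iA; lia.
Qed.

Lemma in_cell_step A x i y : i \in A -> in_cell (A :\ i) (step x i) y -> in_cell A x y.
Proof.
move=> iA H j; move: (H j); rewrite !inE /step; case: eqVneq => [->|] //=.
  by rewrite iA; lia.
by rewrite addn0.
Qed.

Lemma cup_ext F F' A x s :
  (forall y j, in_cell A x y -> F j y = F' j y) -> cup F A x s = cup F' A x s.
Proof.
elim: s A x => [//|k s IH] A x H /=; apply: eq_bigr => i iA.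
rewrite (H (step x i)); last first.
  by apply: (in_cell_step iA); exact: in_cell_refl.
rewrite (H x); last exact: in_cell_refl.
rewrite (IH _ (step x i)) => [|y j /(in_cell_step iA)]; last exact: H.
by rewrite (IH _ x) // => y j /(in_cell_sub iA); exact: H.
Qed.

(** A function constant on the cell has zero coboundary there. When it is the head factor it comes
    out of the sum, which leaves the coboundary of a closed cochain. *)
Lemma cup_const F A x s k : k \in s ->
  (forall y, in_cell A x y -> F k y = F k x) -> cup F A x s = 0.
Proof.
elim: s A x => [//|j s IH] A x; rewrite inE => ks H /=.
case: eqVneq ks => [<- _|_ /= ks]; last first.
  rewrite big1 // => i iA; rewrite !IH ?mulr0 ?addr0 // => y.
    by move=> /(in_cell_sub iA); exact: H.
  move=> /(in_cell_step iA)/H->; apply/esym/H.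
  by apply: (in_cell_step iA); exact: in_cell_refl.
rewrite -[RHS](mulr0 (F k x)) -[X in _ * X](cup_closed F A x s) mulr_sumr.
apply: eq_bigr => i iA; rewrite mulrDr H //.
by apply: (in_cell_step iA); exact: in_cell_refl.
Qed.

(** * Sums over boxes of the grid and the discrete Stokes formula *)

Variable N : nat.
Notation grid := {ffun 'I_d -> 'I_N.+1}.

Implicit Types (B : 'I_d -> pred nat) (g : pt -> 'F_2).

Definition gpt (x : grid) : pt := fun i => x i.

Definition bsum (B : 'I_d -> pred nat) (g : pt -> 'F_2) : 'F_2 :=
  \sum_(x : grid | [forall i, B i (x i)]) g (gpt x).

Definition setB (B : 'I_d -> pred nat) j (P : pred nat) i := if i == j then P else B i.

Lemma eq_bsum B g g' : (forall x : grid, (forall i, B i (x i)) -> g (gpt x) = g' (gpt x)) ->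
  bsum B g = bsum B g'.
Proof. by move=> H; apply: eq_bigr => x /forallP/H. Qed.

Lemma bsum_slices B j g :
  bsum B g = \sum_(t < N.+1 | B j t) bsum (setB B j (pred1 (t : nat))) g.
Proof.
rewrite /bsum (partition_big (fun x : grid => x j) (fun t => B j t)) /=; last first.
  by move=> x /forallP.
apply: eq_bigr => t Bt; apply: eq_bigl => x; apply/andP/forallP => [[/forallP H /eqP <-] i|H].
  by rewrite /setB; case: eqVneq => [->|//]; rewrite /= eqxx.
split; last by have := H j; rewrite /setB eqxx.
apply/forallP => i; have := H i; rewrite /setB; case: eqVneq => [->|//] /= /eqP/val_inj->.
exact: Bt.
Qed.

Lemma bsum_shift B j g t : (t < N)%N ->
  bsum (setB B j (pred1 t)) (fun x => g (step x j)) = bsum (setB B j (pred1 t.+1)) g.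
Proof.
move=> tN; have t1 : (inord t : 'I_N.+1) = t :> nat by rewrite inordK // ltnW.
have t2 : (inord t.+1 : 'I_N.+1) = t.+1 :> nat by rewrite inordK.
pose h v (x : grid) : grid := [ffun i => if i == j then inord v else x i].
rewrite [RHS]/bsum (reindex_onto (h t.+1) (h t)) => [|x /forallP H]; last first.
  apply/ffunP => i; rewrite !ffunE; case: eqVneq => [->|//].
  by have := H j; rewrite /setB eqxx /= => /eqP e; apply/val_inj; rewrite /= t2.
apply: eq_big => [x|x /forallP H].
  apply/forallP/andP => [H|[/forallP H /eqP e] i].
    split; first by apply/forallP => i; have := H i; rewrite /setB ffunE;
      case: eqVneq => //= _ _; rewrite t2.
    apply/eqP/ffunP => i; rewrite !ffunE; case: eqVneq => [->|//].
    by have := H j; rewrite /setB eqxx /= => /eqP ex; apply/val_inj; rewrite /= t1.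
  have := H i; rewrite /setB; case: eqVneq => [->|ne]; last by rewrite ffunE (negbTE ne).
  by move=> _; rewrite -e !ffunE eqxx /= t1.
congr (g _); apply/funext => i; rewrite /step /gpt /h ffunE.
have := H i; rewrite /setB; case: eqVneq => [->|_] /=; last by rewrite addn0.
by move/eqP->; rewrite t2 addn1.
Qed.

Lemma bsum_telescope B j g lo hi : (lo <= hi <= N)%N -> (B j =1 fun t => lo <= t < hi)%N ->
  bsum B (fun x => g (step x j) + g x) =
  bsum (setB B j (pred1 hi)) g + bsum (setB B j (pred1 lo)) g.
Proof.
move=> /andP[lh hN] Bj; pose S t := bsum (setB B j (pred1 t)) g.
rewrite (bsum_slices _ j).
transitivity (\sum_(t < N.+1 | (lo <= t < hi)%N) (S t.+1 + S t)).
  apply: eq_big => [t|t]; rewrite ?Bj // => /andP[_ th].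
  rewrite [LHS]big_split; congr (_ + _).
  by apply: (@bsum_shift B j g t); exact: leq_trans hN.
rewrite -(big_mkord (fun t => lo <= t < hi)%N (fun t => S t.+1 + S t)).
rewrite (big_cat_nat (n := hi)) //=; last by rewrite leqW.
rewrite [X in _ + X]big_nat_cond [X in _ + X]big1 ?addr0; last first.
  by move=> t /andP[/andP[a _] /andP[_ b]]; rewrite ltnNge a in b.
rewrite (big_cat_nat (n := lo)) //=.
rewrite big_nat_cond big1 ?add0r; last first.
  by move=> t /andP[/andP[_ a] /andP[b _]]; rewrite ltnNge b in a.
rewrite -big_nat (eq_big_nat _ _ (F2 := fun t => S t.+1 - S t)) => [|t _].
  rewrite telescope_sumr //; congr (_ + _); apply/eqP.
  by rewrite eq_sym -subr_eq0 opprK addF2.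
by congr (_ + _); apply/eqP; rewrite -subr_eq0 opprK addF2.
Qed.

(** Discrete Stokes formula: each direction of [A] telescopes separately, which leaves the facets.
    [B] is arbitrary in the other directions, so that faces of the cube are covered too. *)
Lemma bsum_cup B F A j s lo hi :
  (forall i, i \in A -> lo i <= hi i <= N)%N ->
  (forall i, i \in A -> B i =1 fun t => lo i <= t < hi i)%N ->
  bsum B (fun x => cup F A x (j :: s)) =
  \sum_(i in A) (bsum (setB B i (pred1 (hi i))) (fun x => F j x * cup F (A :\ i) x s) +
                 bsum (setB B i (pred1 (lo i))) (fun x => F j x * cup F (A :\ i) x s)).
Proof.
move=> lh Bi; rewrite /bsum /= exchange_big /=; apply: eq_bigr => i iA.
exact: (@bsum_telescope B i (fun x => F j x * cup F (A :\ i) x s) (lo i) (hi i) (lh i iA) (Bi i iA)).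
Qed.

Lemma setB_cell (B : 'I_d -> pred nat) A i v (x : grid) y :
  (forall j, setB B i (pred1 v) j (x j)) -> in_cell (A :\ i) (gpt x) y -> y i = v.
Proof.
move=> /(_ i); rewrite /setB eqxx /= => /eqP xi /(_ i); rewrite !inE eqxx /= /gpt xi addn0.
by rewrite andbC -eqn_leq => /eqP.
Qed.

(** Sperner's lemma mod 2, by induction on the dimension of the face where the coordinates outside
    [s] equal [N]. After Stokes, a facet orthogonal to a direction other than [j] vanishes because a
    remaining factor is constant on it; for [j], the facet at 0 has [F j = 0] and the one at [N] is
    the face for the rest of [s]. *)
Lemma sperner F s : uniq s ->
  (forall i x, x i = 0%N -> F i x = 0) -> (forall i x, x i = N -> F i x = 1) ->
  bsum (fun i t => if i \in s then (0 <= t < N)%N else t == N)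
       (fun x => cup F [set i in s] x s) = 1.
Proof.
move=> us F0 F1; elim: s us => [_|j s IH /= /andP[js us]].
  rewrite /bsum (big_pred1 [ffun=> ord_max]) // => x; apply/forallP/eqP => [H|-> i].
    by apply/ffunP => i; rewrite ffunE; have /eqP := H i => /= e; apply/val_inj.
  by rewrite ffunE /=.
rewrite (@bsum_cup _ _ _ _ _ (fun=> 0%N) (fun=> N)) => [|i _|i]; last 2 first.
- by rewrite leq0n leqnn.
- by rewrite inE => ->.
rewrite (bigD1 j) ?inE ?eqxx //= [X in _ + X]big1 => [|i]; last first.
  rewrite !inE => /andP[/orP[->//|si] ij].
  suff E v (Fv : forall x y : pt, x i = v -> y i = v -> F i x = F i y) :
    bsum (setB (fun k t => if k \in j :: s then (0 <= t < N)%N else t == N) i (pred1 v))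
      (fun x => F j x * cup F ([set k in j :: s] :\ i) x s) = 0.
    rewrite !E ?addr0 // => x y xi yi; first by rewrite (F0 _ _ xi) (F0 _ _ yi).
  by rewrite (F1 _ _ xi) (F1 _ _ yi).
  rewrite /bsum big1 // => x /forallP Hx; rewrite (@cup_const _ _ _ _ i) ?mulr0 // => y Hy.
  apply: Fv; first exact: setB_cell Hx Hy.
  by apply: (setB_cell (A := [set: 'I_d]) Hx); exact: in_cell_refl.
rewrite addr0 [X in _ + X](_ : _ = 0) => [|]; last first.
  rewrite /bsum big1 // => x /forallP /(_ j); rewrite /setB eqxx /= => /eqP x0.
  by rewrite F0 ?mul0r.
rewrite addr0 -[RHS](IH us).
have As : [set i in j :: s] :\ j = [set i in s].
  by apply/setP => i; rewrite !inE; case: eqVneq => // ->; rewrite (negbTE js).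
rewrite As; transitivity (bsum (setB
    (fun k t => if k \in j :: s then (0 <= t < N)%N else t == N) j (pred1 N))
    (fun x => cup F [set i in s] x s)).
  apply: eq_bsum => x /(_ j); rewrite /setB eqxx /= => /eqP xN.
  by rewrite F1 ?mul1r.
apply: eq_bigl => x; apply: eq_forallb => i; rewrite /setB inE.
by case: eqVneq => [->|] //=; rewrite (negbTE js).
Qed.

Definition cup_all F x := cup F [set: 'I_d] x (enum 'I_d).

(* Boxes of side [l] of the grid, indexed by their position [c] in the coarse
   grid of mesh [l]. *)
Definition box_degree F (l : nat) (c : pt) : 'F_2 :=
  bsum (fun i t => t %/ l == c i)%N (cup_all F).

Lemma box_degree_whole F : (0 < N)%N -> (0 < d)%N ->
  (forall i x, x i = 0%N -> F i x = 0) -> (forall i x, x i = N -> F i x = 1) ->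
  box_degree F N (fun=> 0%N) = 1.
Proof.
move=> N0 d0 F0 F1; rewrite -[RHS](sperner (enum_uniq 'I_d) F0 F1).
rewrite (_ : [set i in _] = [set: 'I_d]); last by apply/setP => i; rewrite !inE mem_enum.
apply: eq_bigl => x; apply: eq_forallb => i; rewrite mem_enum /=.
by rewrite eqn0Ngt divn_gt0 // -ltnNge.
Qed.

Lemma box_degree_split F (r l : nat) c : (0 < l)%N -> (0 < r)%N ->
  box_degree F (r * l) c != 0 ->
  exists c' : grid, (forall i, c' i %/ r = c i)%N /\ box_degree F l (gpt c') != 0.
Proof.
move=> l0 r0 H.
pose p (x : grid) : grid := [ffun i => inord (x i %/ l)%N].
have pE (x : grid) i : p x i = (x i %/ l)%N :> nat.
  by rewrite ffunE inordK // (leq_ltn_trans (leq_div _ _)).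
have [/existsP[c' /andP[/forallP e nz]]|/existsPn no] :=
  boolP [exists c' : grid, [forall i, c' i %/ r == c i]%N && (box_degree F l (gpt c') != 0)].
  by exists c'; split=> // i; apply/eqP.
case/eqP: H; rewrite /box_degree /bsum.
rewrite (partition_big p (fun c' : grid => [forall i, (c' i %/ r)%N == c i])) /=; last first.
  by move=> x /forallP Hx; apply/forallP => i; rewrite pE -divnMA mulnC.
rewrite big1 // => c' Hc'; have := no c'; rewrite Hc' /= negbK => /eqP nc; rewrite -[RHS]nc.
apply: eq_bigl => x; apply/andP/forallP => [[_ /eqP <-] i|Hx]; first by rewrite /gpt pE.
have px : p x = c'.
  by apply/ffunP => i; apply/val_inj; rewrite /= pE; apply/eqP; exact: Hx.
split; last by rewrite px.
by apply/forallP => i; rewrite mulnC divnMA -pE px; move/forallP: Hc'; exact.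
Qed.

(** By the Stokes formula only cells lying in the facets matter. In the closed box a coordinate
    divisible by [l] is at one of its two ends, so the hypothesis concerns boundary points only. *)
Lemma box_degree_ext F F' l c : (0 < l)%N -> (0 < d)%N ->
  (forall i, (c i).+1 * l <= N)%N ->
  (forall y j, (forall i, c i * l <= y i <= (c i).+1 * l)%N ->
     (exists i, l %| y i)%N -> F j y = F' j y) ->
  box_degree F l c = box_degree F' l c.
Proof.
move=> l0 d0 cN H; rewrite /box_degree /cup_all.
case: (enum 'I_d) => [//|j s]; pose lo i := (c i * l)%N; pose hi i := ((c i).+1 * l)%N.
have lh i : i \in [set: 'I_d] -> (lo i <= hi i <= N)%N.
  by move=> _; rewrite cN leq_mul2r leqnSn orbT.
have Bi i : i \in [set: 'I_d] -> (fun t => t %/ l == c i)%N =1 (fun t => lo i <= t < hi i)%N.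
  by move=> _ t; rewrite eqn_leq -ltnS ltn_divLR // leq_divRL // andbC.
rewrite !(@bsum_cup _ _ _ _ _ lo hi) //; apply: eq_bigr => i _.
suff E v : (v == lo i) || (v == hi i) ->
   bsum (setB (fun (i0 : 'I_d) (t : nat) => (t %/ l)%N == c i0) i (pred1 v))
     (fun x => F j x * cup F ([set: 'I_d] :\ i) x s) =
   bsum (setB (fun (i0 : 'I_d) (t : nat) => (t %/ l)%N == c i0) i (pred1 v))
     (fun x => F' j x * cup F' ([set: 'I_d] :\ i) x s).
  by rewrite !E // eqxx ?orbT.
move=> Ev; apply: eq_bsum => x Hx.
have Hc y k : in_cell ([set: 'I_d] :\ i) (gpt x) y -> F k y = F' k y.
  move=> Hy; have yi := setB_cell Hx Hy.
  apply: H => [m|]; last first.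
    by exists i; rewrite yi; case/orP: Ev => /eqP->; rewrite dvdn_mull.
  case: (eqVneq m i) => [->|mi].
    by rewrite yi; case/orP: Ev => /eqP->; have /andP[] := lh i (finset.in_setT i);
      rewrite /lo /hi leqnn => -> //.
  have := Hx m; rewrite /setB (negbTE mi) => /= Hm; have := Bi m (finset.in_setT m) (x m).
  rewrite /= Hm => /esym; have := Hy m; rewrite !inE mi /= /gpt /lo /hi; lia.
by rewrite (cup_ext s Hc) Hc //; exact: in_cell_refl.
Qed.

Definition in_unit_cell (x y : pt) := forall i, (x i <= y i <= (x i).+1)%N.

Lemma box_degree1 F c k : box_degree F 1 c != 0 ->
  exists y y', [/\ in_unit_cell c y, in_unit_cell c y' & F k y != F k y'].
Proof.
move=> H; apply: contrapT => no; case/eqP: H; rewrite /box_degree /bsum big1 // => x /forallP Hx.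
have xc : gpt x = c by apply/funext => i; have := Hx i; rewrite divn1 => /eqP.
rewrite xc /cup_all; apply: (@cup_const _ _ _ _ k); first by rewrite mem_enum.
move=> y Hy; apply: contrapT => /eqP ne; apply: no; exists y, c; split=> // i.
  by have := Hy i; rewrite inE addn1.
by rewrite leqnn leqnSn.
Qed.

End Parity.

Local Open Scope classical_set_scope.

(** * The deterministic algorithm *)

Lemma rV_norm_leP (R : realType) (d : nat) (x : 'rV[R]_d) (a : R) : 0 <= a ->
  `|x| <= a <-> forall i, `|x ord0 i| <= a.
Proof.
move=> a0; have -> : `|x| = \big[Num.max/0]_ij `|x ij.1 ij.2| by exact: mx_normrE.
split => [H i|H].
  by apply: le_trans H; exact: (le_bigmax _ (fun ij : 'I_1 * 'I_d => `|x ij.1 ij.2|) (ord0, i)).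
by apply/bigmax_leP; split=> // -[i j] _ /=; rewrite (ord1 i).
Qed.

Lemma rV_norm_coord (R : realType) (d : nat) (x : 'rV[R]_d) i : `|x ord0 i| <= `|x|.
Proof. by apply: (rV_norm_leP x (normr_ge0 x)).1. Qed.

Lemma rV_normB_coord (R : realType) (d : nat) (x y : 'rV[R]_d) i :
  `|x ord0 i - y ord0 i| <= `|x - y|.
Proof. by have := rV_norm_coord (x - y) i; rewrite !mxE. Qed.

Lemma rV_normB_leP (R : realType) (d : nat) (x y : 'rV[R]_d) (a : R) : 0 <= a ->
  `|x - y| <= a <-> forall i, `|x ord0 i - y ord0 i| <= a.
Proof. by move=> /rV_norm_leP->; split=> H i; have := H i; rewrite !mxE. Qed.

Lemma cube_valP (R : realType) (d : nat) (x : cube R d) i : 0 <= val x ord0 i <= 1.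
Proof. by have := set_valP x; apply. Qed.

Lemma card_multiples (M a r l : nat) : (0 < l)%N ->
  (#|[pred t : 'I_M | (a * l <= t <= (a + r) * l) && (l %| t)]| <= r.+1)%N.
Proof.
move=> l0; set A := [pred t : 'I_M | _]; rewrite -[leqRHS]card_ord.
pose f (t : 'I_M) : 'I_r.+1 := inord (t %/ l - a).
have fE t : t \in A -> (a <= t %/ l)%N /\ f t = (t %/ l - a)%N :> nat.
  rewrite inE /= => /andP[/andP[a1 a2] _]; split; first by rewrite leq_divRL.
  by rewrite inordK // ltnS leq_subLR -(leq_pmul2r l0) (leq_trans (leq_divM _ _)).
have /card_in_image <- : {in A &, injective f}.
  move=> t u tA uA e; have [a1 e1] := fE t tA; have [a2 e2] := fE u uA.
  have : (t %/ l - a = u %/ l - a)%N by rewrite -e1 -e2 e.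
  move=> e3; have e4 : (t %/ l = u %/ l)%N by lia.
  move: tA uA; rewrite !inE => /andP[_ /divnK tl] /andP[_ /divnK ul].
  by apply/val_inj; rewrite /= -tl -ul e4.
exact: max_card.
Qed.

Section GridAlgorithm.
Variables (R : realType) (d N : nat).
Notation pt := ('I_d -> nat).
Notation grid := {ffun 'I_d -> 'I_N.+1}.
Hypothesis N0 : (0 < N)%N.

(** Coordinates are cut off at [N] so that every [pt] yields a point of the cube. *)
Definition grid_row (y : pt) : 'rV[R]_d := \row_i ((minn (y i) N)%:R / N%:R).

Lemma grid_row_cube y : grid_row y \in cube R d.
Proof.
apply/mem_set => i; rewrite mxE divr_ge0 //= ler_pdivrMr ?ltr0n // mul1r ler_nat.
exact: geq_minr.
Qed.

Definition grid_cube (y : pt) : cube R d := exist _ (grid_row y) (grid_row_cube y).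

Lemma grid_cubeE y i : (y i <= N)%N -> val (grid_cube y) ord0 i = (y i)%:R / N%:R.
Proof. by move=> yN; rewrite mxE (minn_idPl yN). Qed.

Implicit Type F : cube R d -> cube R d.

(** Label 1 goes with a nonpositive coordinate of F x - x, label 0 with a nonnegative one. The
    values imposed at 0 and [N], which [box_degree_whole] needs, respect this because F maps into
    the cube. *)
Definition label F (i : 'I_d) (y : pt) : 'F_2 :=
  if (y i == N) || ((y i != 0%N) &&
      (val (F (grid_cube y)) ord0 i < val (grid_cube y) ord0 i)) then 1 else 0.

Lemma label0 F i y : y i = 0%N -> label F i y = 0.
Proof. by rewrite /label => ->; rewrite eqxx /= eq_sym eqn0Ngt N0. Qed.

Lemma labelN F i y : y i = N -> label F i y = 1.
Proof. by rewrite /label => ->; rewrite eqxx. Qed.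

(** Divisibility of some coordinate by [l] describes the union of the boundaries of the boxes of
    side [l]. *)
Definition box_queries (r l : nat) (c : pt) : seq (cube R d) :=
  [seq grid_cube (gpt y) | y : grid <- enum [pred y : grid |
     [forall i, c i * (r * l) <= y i <= (c i).+1 * (r * l)]%N &&
     [exists i, l %| y i]%N]].

(* By [box_degree_ext] the degrees of the smaller boxes are determined by the
   answers, so that they can be computed from any map consistent with them. *)
Definition next_box (r l : nat) (c : pt) (ans : seq (cube R d)) : pt :=
  xget c [set c' | exists F, [/\ map F (box_queries r l c) = ans,
    forall i, (c' i %/ r)%N = c i & box_degree N (label F) l c' != 0]].

Fixpoint grid_algorithm (rs : seq nat) (c : pt) : algorithm (cube R d) (size rs) :=
  match rs with
  | [::] => Output (grid_cube c)
  | r :: rs' => let l := \prod_(s <- rs') s in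
      Round (box_queries r l c) (fun ans => grid_algorithm rs' (next_box r l c ans))
  end.

(** Invariant: the current box has odd degree for the labelling of the true map. [next_box] may use
    another map, but both agree on the queried walls, so the box it selects has odd degree for the
    true map as well. *)
Lemma grid_algorithm_output F rs c : (0 < d)%N -> all (leq 1) rs ->
  (forall i, (c i).+1 * \prod_(s <- rs) s <= N)%N ->
  box_degree N (label F) (\prod_(s <- rs) s)%N c != 0 ->
  exists c', [/\ output F (grid_algorithm rs c) = grid_cube c',
    forall i, (c' i < N)%N & box_degree N (label F) 1 c' != 0].
Proof.
move=> d0; elim: rs c => [|r rs IH] c /=.
  rewrite big_nil => _ cN nz; exists c; split=> // i.
  by have := cN i; rewrite muln1.
rewrite big_cons => /andP[r0 rs0] cN nz; set l := (\prod_(s <- rs) s)%N in cN nz *.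
have l0 : (0 < l)%N by rewrite /l big_seq prodn_cond_gt0 // => s; move: s; exact/allP.
have [c1 [c1r nz1]] := box_degree_split l0 r0 nz.
set c' := next_box _ _ _ _.
have [F' [eF c'r nz']] : exists F', [/\ map F' (box_queries r l c) = map F (box_queries r l c),
    forall i, (c' i %/ r)%N = c i & box_degree N (label F') l c' != 0].
  (* The default value of [xget] is excluded: [F] and the box [c1] satisfy the conditions. *)
  rewrite /c' /next_box; case: xgetP => [x _ //|no].
  by exfalso; apply: (no (gpt c1)); exists F.
have cc i : (c i * r <= c' i < (c i).+1 * r)%N.
  by rewrite -c'r leq_divM ltn_ceil.
have c'N i : ((c' i).+1 * l <= N)%N.
  apply: leq_trans (cN i); rewrite mulnA leq_mul2r; apply/orP; right.
  by have /andP[] := cc i.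
apply: IH => //; rewrite -(@box_degree_ext _ _ (label F')) // => y j yc yl.
have yN i : (y i < N.+1)%N.
  by rewrite ltnS; apply: leq_trans (c'N i); have /andP[] := yc i.
pose y' : grid := [ffun i => Ordinal (yN i)].
have y'E : gpt y' = y by apply/funext => i; rewrite /gpt ffunE.
have ymem : y' \in enum [pred y : grid |
     [forall i, c i * (r * l) <= y i <= (c i).+1 * (r * l)]%N && [exists i, l %| y i]%N].
  rewrite mem_enum inE; apply/andP; split; last first.
    by apply/existsP; case: yl => i yi; exists i; rewrite ffunE.
  apply/forallP => i; rewrite ffunE /=; have /andP[a1 a2] := yc i; have /andP[b1 b2] := cc i.
  rewrite !mulnA (leq_trans _ a1) ?leq_mul2r ?b1 ?orbT //=.
  by rewrite (leq_trans a2) // leq_mul2r b2 orbT.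
have eFy : F' (grid_cube y) = F (grid_cube y).
  move: eF; rewrite /box_queries -!map_comp => /eq_in_map /(_ _ ymem) /=.
  by rewrite y'E.
by rewrite /label eFy.
Qed.

Definition round_cost (r l : nat) := (d * (r.+1 * (r * l).+1 ^ d.-1))%N.

(** Union over the direction in which the coordinate is a multiple of [l]: at most [r.+1] values in
    that direction and [(r * l).+1] in each other one. *)
Lemma size_box_queries r l c : (0 < l)%N -> (size (box_queries r l c) <= round_cost r l)%N.
Proof.
move=> l0; rewrite size_map -cardE.
pose P i := [pred y : grid | [forall k, c k * (r * l) <= y k <= (c k).+1 * (r * l)]%N && (l %| y i)%N].
apply: (@leq_trans (\sum_(i < d) #|P i|)%N).
  under [leqRHS]eq_bigr do rewrite -sum1_card big_mkcond /=.
  rewrite exchange_big /= -sum1_card big_mkcond /=; apply: leq_sum => y _.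
  case: ifP => //; rewrite inE => /andP[y1 /existsP[i yi]].
  by rewrite (bigD1 i) //= inE /= y1 yi.
rewrite /round_cost -[X in (_ <= X * _)%N](card_ord d) -sum_nat_const; apply: leq_sum => i _.
pose Q k := [pred t : 'I_N.+1 | (c k * (r * l) <= t <= (c k).+1 * (r * l)) && ((k == i) ==> (l %| t))]%N.
apply: (@leq_trans #|family (fun k => mem (Q k))|).
  apply: subset_leq_card; apply/fintype.subsetP => y; rewrite inE => /andP[/forallP y1 y2].
  by apply/familyP => k; rewrite inE /= y1 /=; apply/implyP => /eqP->.
rewrite card_family foldrE big_map big_enum /= (bigD1 i) //=.
have -> : d.-1 = #|[pred k : 'I_d | k != i]|.
  by have := cardC1 i; rewrite card_ord => <-.
rewrite -prod_nat_const; apply: leq_mul; last first.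
  apply: leq_prod => k ki.
  apply: leq_trans (card_multiples N.+1 (c k * (r * l)) (r * l) (l := 1) isT).
  apply: subset_leq_card; apply/fintype.subsetP => t; rewrite !inE (negbTE ki) /= => /andP[H _].
  by rewrite dvd1n andbT !muln1 addnC -mulSn.
apply: leq_trans (card_multiples N.+1 (c i * r) r l0).
apply: subset_leq_card; apply/fintype.subsetP => t; rewrite !inE eqxx /= => /andP[H ->].
by rewrite andbT addnC -mulSn -!mulnA.
Qed.

Fixpoint total_cost (rs : seq nat) : nat :=
  if rs is r :: rs' then (round_cost r (\prod_(s <- rs') s) + total_cost rs')%N else 0%N.

Lemma grid_algorithm_count F rs c : all (leq 1) rs ->
  (query_count F (grid_algorithm rs c) <= total_cost rs)%N.
Proof.
elim: rs c => [//|r rs IH] c /= /andP[r0 rs0]; apply: leq_add; last exact: IH.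
by apply: size_box_queries; rewrite big_seq prodn_cond_gt0 // => s; move: s; exact/allP.
Qed.

(** A discrete intermediate value argument: the coordinate of F x - x takes both signs on the cell
    and differs from its value at the corner [c] by at most (L + 1) / N. *)
Lemma label_change F (L : R) c i : 0 <= L -> lipschitz_maps L F -> (forall j, c j < N)%N ->
  (exists y y', [/\ in_unit_cell c y, in_unit_cell c y' & label F i y != label F i y']) ->
  `|val (F (grid_cube c)) ord0 i - val (grid_cube c) ord0 i| <= (L + 1) / N%:R.
Proof.
move=> L0 FL cN [y [y' [cy cy' ne]]].
pose g z := val (F (grid_cube z)) ord0 i - val (grid_cube z) ord0 i.
have Nr : 0 < N%:R :> R by rewrite ltr0n.
have cell z j : in_unit_cell c z -> (z j <= N)%N.
  by move=> /(_ j); have := cN j; lia.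
have close z : in_unit_cell c z -> `|g z - g c| <= (L + 1) / N%:R.
  move=> cz; have dist : `|val (grid_cube z) - val (grid_cube c)| <= N%:R^-1.
    apply/rV_norm_leP; first by rewrite invr_ge0 ltW.
    move=> j; rewrite !mxE.
    have cjN := ltnW (cN j).
    rewrite (minn_idPl (cell _ j cz)) (minn_idPl cjN).
    rewrite -mulrBl normrM [X in _ * X]gtr0_norm ?invr_gt0 // ler_piMl ?invr_ge0 ?(ltW Nr) //.
    have /andP[z1 z2] := cz j; rewrite -natrB // normr_nat -[X in _ <= X]/(1%:R) ler_nat.
    by move: z1 z2; lia.
  have Fd := FL (grid_cube z) (grid_cube c).
  have c1 := rV_normB_coord (val (F (grid_cube z))) (val (F (grid_cube c))) i.
  have c2 := rV_normB_coord (val (grid_cube z)) (val (grid_cube c)) i.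
  have -> : g z - g c = (val (F (grid_cube z)) ord0 i - val (F (grid_cube c)) ord0 i)
     - (val (grid_cube z) ord0 i - val (grid_cube c) ord0 i) by rewrite /g; ring.
  apply: le_trans (ler_normB _ _) _; rewrite mulrDl mul1r; apply: lerD.
    by apply: le_trans c1 (le_trans Fd _); apply: ler_wpM2l.
  by apply: le_trans c2 _.
have lab1 z : in_unit_cell c z -> label F i z = 1 -> g z <= 0.
  move=> cz; rewrite /label; case: ifP => // /orP[/eqP zN _|/andP[_ lt] _].
    rewrite /g (@grid_cubeE z i) ?zN // divff ?gt_eqF // subr_le0.
    by have /andP[] := cube_valP (F (grid_cube z)) i.
  by rewrite /g subr_le0 ltW.
have lab0 z : in_unit_cell c z -> label F i z = 0 -> 0 <= g z.
  move=> cz; rewrite /label; case: ifP => //; case: eqVneq => //= _.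
  case: eqVneq => /= [z0 _ _|_ /negbT]; last by rewrite -leNgt /g subr_ge0.
  rewrite /g (@grid_cubeE z i) ?z0 // mul0r subr0.
  by have /andP[] := cube_valP (F (grid_cube z)) i.
have lab z : label F i z = 0 \/ label F i z = 1 by rewrite /label; case: ifP; [right|left].
have C1 := close _ cy; have C2 := close _ cy'.
rewrite -[X in `|X|]/(g c) ler_norml.
move: C1 C2; rewrite !ler_distl => /andP[a1 a2] /andP[b1 b2].
case: (lab y) (lab y') => [e1|e1] [e2|e2]; move: ne; rewrite e1 e2 ?eqxx // => _.
  by have := lab0 _ cy e1; have := lab1 _ cy' e2; lra.
by have := lab1 _ cy e1; have := lab0 _ cy' e2; lra.
Qed.

Lemma grid_algorithm_solves rs (L eps : R) : (0 < d)%N -> 0 <= L -> all (leq 1) rs ->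
  (\prod_(s <- rs) s)%N = N -> L + 1 <= eps * N%:R ->
  det_solves L eps (grid_algorithm rs (fun=> 0%N)).
Proof.
move=> d0 L0 rs0 pN Le F FL; have Nr : 0 < N%:R :> R by rewrite ltr0n.
have [||c [-> cN nz]] := @grid_algorithm_output F rs (fun=> 0%N) d0 rs0.
- by move=> i; rewrite mul1n pN.
- by rewrite pN (box_degree_whole N0 d0 (label0 F) (labelN F)) oner_neq0.
apply/rV_normB_leP.
  by rewrite -(pmulr_lge0 _ Nr); apply: le_trans Le; apply: addr_ge0.
move=> i; have := label_change L0 FL cN (box_degree1 i nz).
move=> H; apply: le_trans H _; by rewrite ler_pdivrMr.
Qed.

End GridAlgorithm.

(** * Maps with a hidden path *)

Section MonotonePaths.
Variables (R : realType) (d : nat).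
Notation vec := ('I_d -> R).
Implicit Types (p q : vec) (qs rs : seq vec) (s : R).

Definition coord_sum p : R := \sum_i p i.

(* Going from [p] to [q] one coordinate after the other, [knot p q m] is the
   coordinate sum reached when the first [m] coordinates have been changed.
   Paths are parametrized by their coordinate sum. *)
Definition knot p q (m : nat) : R := \sum_(i < d) (if (i < m)%N then q i else p i).

(** For [p] below [q] this is 0 before coordinate [i] moves and [q i - p i] afterwards; as a
    difference of minima it telescopes when summed over [i]. *)
Definition leg p q s (i : 'I_d) : R := Num.min s (knot p q i.+1) - Num.min s (knot p q i).

Fixpoint travel p qs s (i : 'I_d) : R :=
  if qs is q :: qs' then leg p q s i + travel q qs' s i else 0.

Fixpoint chain p qs : Prop :=
  if qs is q :: qs' then (forall i : 'I_d, p i <= q i) /\ chain q qs' else True.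

Lemma knot0 p q : knot p q 0 = coord_sum p.
Proof. by []. Qed.

Lemma knotd p q : knot p q d = coord_sum q.
Proof. by apply: eq_bigr => i _; rewrite ltn_ord. Qed.

Lemma knotS p q (i : 'I_d) : knot p q i.+1 - knot p q i = q i - p i.
Proof.
rewrite /knot -sumrB (bigD1 i) //= ltnSn ltnn big1 ?addr0 // => j ji.
rewrite ltnS leq_eqVlt (_ : (j == i :> nat) = false) ?subrr //.
by apply/negbTE.
Qed.

Lemma knot_mono p q m n : (forall i : 'I_d, p i <= q i) -> (m <= n)%N -> knot p q m <= knot p q n.
Proof.
move=> pq mn; apply: ler_sum => i _; case: ifP => im; first by rewrite (leq_trans im).
by case: ifP => // _; apply: pq.
Qed.

Lemma coord_sum_le p q : (forall i : 'I_d, p i <= q i) -> coord_sum p <= coord_sum q.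
Proof. by move=> pq; apply: ler_sum => i _; apply: pq. Qed.

Lemma chain_le p qs i : chain p qs -> p i <= last p qs i.
Proof. by elim: qs p => [//|q qs IH] p /= [pq /IH]; apply: le_trans. Qed.

Lemma chain_cat p qs rs : chain p (qs ++ rs) <-> chain p qs /\ chain (last p qs) rs.
Proof.
elim: qs p => [|q qs IH] p /=; first by tauto.
by have := IH q; tauto.
Qed.

Lemma travel_cat p qs rs s i :
  travel p (qs ++ rs) s i = travel p qs s i + travel (last p qs) rs s i.
Proof. by elim: qs p => [|q qs IH] p /=; rewrite ?add0r // IH addrA. Qed.

Lemma leg_before p q s (i : 'I_d) : (forall i : 'I_d, p i <= q i) -> s <= knot p q i -> leg p q s i = 0.
Proof.
move=> pq H; rewrite /leg !min_l ?subrr //.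
by apply: le_trans H _; apply: knot_mono.
Qed.

Lemma leg_after p q s (i : 'I_d) : (forall i : 'I_d, p i <= q i) ->
  knot p q i.+1 <= s -> leg p q s i = q i - p i.
Proof.
move=> pq H; rewrite /leg !min_r ?knotS //.
by apply: le_trans H; apply: knot_mono.
Qed.

Lemma travel_before p qs s i : chain p qs -> s <= coord_sum p -> travel p qs s i = 0.
Proof.
elim: qs p => [//|q qs IH] p /= [pq cq] sp; rewrite IH //; last first.
  by apply: le_trans sp _; apply: coord_sum_le.
rewrite leg_before ?addr0 //.
by apply: le_trans sp _; rewrite -(knot0 p q); apply: knot_mono.
Qed.

Lemma travel_after p qs s i : chain p qs -> coord_sum (last p qs) <= s ->
  travel p qs s i = last p qs i - p i.
Proof.
elim: qs p => [|q qs IH] p /=; first by rewrite subrr.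
move=> [pq cq] sq; rewrite IH // leg_after //; first by rewrite addrC addrA subrK.
apply: le_trans sq; apply: (@le_trans _ _ (coord_sum q)); last first.
  by apply: coord_sum_le => j; apply: chain_le.
by rewrite -(knotd p q); apply: knot_mono.
Qed.

Lemma travel_mono p qs s t i : chain p qs -> s <= t -> travel p qs s i <= travel p qs t i.
Proof.
elim: qs p => [//|q qs IH] p /= [pq cq] st; apply: lerD; last exact: IH.
have := @knot_mono p q i i.+1 pq (leqnSn i); rewrite /leg.
move: (knot _ _ _) (knot _ _ _) => a b ab.
by rewrite /Num.min; do !case: ltP => ?; lra.
Qed.

Lemma sum_travel p qs s : chain p qs ->
  \sum_i travel p qs s i = Num.min s (coord_sum (last p qs)) - Num.min s (coord_sum p).
Proof.
elim: qs p => [|q qs IH] p /=; first by rewrite big1 ?subrr.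
move=> [pq cq]; rewrite big_split /= IH // [X in X + _ = _](_ : _ =
  Num.min s (coord_sum q) - Num.min s (coord_sum p)); first by rewrite addrC addrA subrK.
rewrite -(knotd p q) -(knot0 p q) -(big_mkord xpredT
  (fun i => Num.min s (knot p q i.+1) - Num.min s (knot p q i))).
by rewrite telescope_sumr.
Qed.

(** No coordinate decreases and the increments add up to at most the elapsed time, so none of them
    exceeds it. *)
Lemma travel_lip p qs s t i : chain p qs -> `|travel p qs s i - travel p qs t i| <= `|s - t|.
Proof.
move=> c; wlog st : s t / s <= t.
  by move=> H; case: (leP s t) => [/H//|/ltW/H]; rewrite distrC (distrC t).
rewrite distrC (distrC s) !ger0_norm ?subr_ge0 ?travel_mono //.
apply: (@le_trans _ _ (\sum_j (travel p qs t j - travel p qs s j))).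
  rewrite (bigD1 i) //= ler_wpDr // sumr_ge0 // => j _.
  by rewrite subr_ge0 travel_mono.
rewrite sumrB !sum_travel //.
have := coord_sum_le (fun j => chain_le j c).
move: (coord_sum _) (coord_sum _) => a b ab.
by rewrite /Num.min; do !case: ltP => ?; lra.
Qed.

Definition meets (rho : R) (x : vec) p qs := exists s,
  coord_sum p <= s <= coord_sum (last p qs) /\
  forall i, `|x i - (p i + travel p qs s i)| < rho.

Definition meets_leg (rho : R) (x : vec) p q (j : 'I_d) := forall i : 'I_d,
  if (i < j)%N then `|x i - q i| < rho
  else if i == j then p i - rho < x i < q i + rho
  else `|x i - p i| < rho.

Lemma meets_nil rho x p : meets rho x p [::] -> forall i, `|x i - p i| < rho.
Proof. by case=> s [_ H] i; have := H i; rewrite /= addr0. Qed.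

Lemma meets_cons rho x p q qs : (0 < d)%N -> chain p (q :: qs) ->
  meets rho x p (q :: qs) -> (exists j, meets_leg rho x p q j) \/ meets rho x q qs.
Proof.
move=> d0 /= [pq cq] [s [/andP[ps sl] H]].
case: (leP s (coord_sum q)) => sq; last first.
  right; exists s; split; first by rewrite (ltW sq).
  move=> i; have := H i; rewrite /= leg_after //; first by rewrite addrA [p i + _]addrC subrK.
  by apply: le_trans (ltW sq); rewrite -(knotd p q); apply: knot_mono.
(* The minimal such [m] is the coordinate that is moving at time [s]. *)
left; have ex : exists m, (m < d)%N && (s <= knot p q m.+1).
  by exists d.-1; rewrite prednK // leqnn knotd.
case: (ex_minnP ex) => m /andP[md sm] mmin; exists (Ordinal md) => i /=.
have mk : knot p q m <= s.
  case: m md sm mmin => [//|m] md sm mmin; rewrite leNgt; apply/negP => lt.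
  by have := mmin m; rewrite (ltnW md) (ltW lt) ltnn => /(_ isT).
have := H i; rewrite /= travel_before // addr0; case: ltnP => im.
  rewrite leg_after //; first by rewrite (addrC (p i)) subrK.
  by apply: le_trans mk; apply: knot_mono.
case: eqVneq => [ei|ne]; last first.
  rewrite leg_before ?addr0 //; apply: le_trans sm _; apply: knot_mono => //.
  by rewrite ltn_neqAle im andbT eq_sym.
have := @knotS p q i; have := @knot_mono p q i i.+1 pq (leqnSn i); rewrite /leg ei /=.
move: mk sm; move: (knot _ _ _) (knot _ _ _) => a b h1 h2 h3 h4.
rewrite min_l // min_r // ltr_norml => /andP[h5 h6]; lra.
Qed.

End MonotonePaths.

(** * The map of a path: Lipschitz constant, approximate fixed points, locality *)

Lemma dist_min (R : realType) (a b a' b' D : R) : `|a - a'| <= D -> `|b - b'| <= D ->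
  `|Num.min a b - Num.min a' b'| <= D.
Proof.
rewrite !ler_norml => /andP[? ?] /andP[? ?].
by rewrite /Num.min; do !case: ltP => ?; apply/andP; split; lra.
Qed.

Lemma dist_max (R : realType) (a b a' b' D : R) : `|a - a'| <= D -> `|b - b'| <= D ->
  `|Num.max a b - Num.max a' b'| <= D.
Proof.
rewrite !ler_norml => /andP[? ?] /andP[? ?].
by rewrite /Num.max; do !case: ltP => ?; apply/andP; split; lra.
Qed.

Section HiddenPath.
Variables (R : realType) (d : nat) (w sigma : R).
Notation vec := ('I_d -> R).
Implicit Types (qs rs : seq vec) (x y : 'rV[R]_d).
Hypotheses (d0 : (0 < d)%N) (w0 : 0 < w) (sigma0 : 0 < sigma).

Notation dR := (@GRing.natmul R 1 d).
Notation origin := (fun=> @GRing.zero R).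

(** The reference is the path point with the coordinate sum of [x] rather than a nearest point, so
    that it depends on [x] in a Lipschitz way. *)
Definition offset qs x : 'rV[R]_d :=
  \row_i (x ord0 i - travel origin qs (coord_sum (x ord0)) i).

(* Inside the tube of radius [2 d w] around the path, the field increases the
   coordinates lagging behind the point of the path with the same coordinate
   sum; far from the path and beyond its end it decreases all coordinates. *)
Definition field qs x (i : 'I_d) : R :=
  Num.max (- w) (Num.min w (Num.min (w - offset qs x ord0 i)
    (Num.min ((2 * dR + 1) * w - `|offset qs x|)
      (coord_sum (last origin qs) - coord_sum (x ord0))))).

Definition clip (a : R) : R := Num.max 0 (Num.min 1 a).

Definition path_row qs x : 'rV[R]_d := \row_i clip (x ord0 i + sigma * field qs x i).

Lemma path_row_cube qs x : path_row qs x \in cube R d.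
Proof.
by apply/mem_set => i; rewrite mxE /clip le_max lexx ge_max ler01 ge_min lexx.
Qed.

Definition path_map qs (x : cube R d) : cube R d :=
  exist _ (path_row qs (val x)) (path_row_cube qs (val x)).

Lemma coord_sum_dist x y : `|coord_sum (x ord0) - coord_sum (y ord0)| <= dR * `|x - y|.
Proof.
rewrite /coord_sum -sumrB; apply: le_trans (ler_norm_sum _ _ _) _.
rewrite -[X in X%:R * _]card_ord mulr_natl -sumr_const; apply: ler_sum => i _.
exact: rV_normB_coord.
Qed.

Lemma offset_lip qs x y : chain origin qs -> `|offset qs x - offset qs y| <= (dR + 1) * `|x - y|.
Proof.
move=> c; apply/rV_normB_leP; first by rewrite mulr_ge0 ?addr_ge0.
move=> i; rewrite !mxE opprD addrACA; apply: le_trans (ler_normD _ _) _.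
rewrite [leRHS]mulrDl mul1r [leRHS]addrC; apply: lerD; first exact: rV_normB_coord.
rewrite -opprD normrN; apply: le_trans (travel_lip _ _ _ c) _; exact: coord_sum_dist.
Qed.

Lemma field_lip qs x y i : chain origin qs ->
  `|field qs x i - field qs y i| <= (dR + 1) * `|x - y|.
Proof.
move=> c; have D0 : 0 <= (dR + 1) * `|x - y| by rewrite mulr_ge0 ?addr_ge0.
have E (a b b' : R) : (a - b) - (a - b') = b' - b by ring.
apply: dist_max; first by rewrite subrr normr0.
apply: dist_min; first by rewrite subrr normr0.
apply: dist_min.
  rewrite E distrC; apply: le_trans (offset_lip x y c); exact: rV_normB_coord.
apply: dist_min.
  rewrite E distrC; apply: le_trans (offset_lip x y c); exact: ler_dist_dist.
rewrite E distrC; apply: le_trans (coord_sum_dist x y) _.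
by rewrite ler_wpM2r // lerDl.
Qed.

Lemma path_map_lipschitz qs (L : R) : chain origin qs -> sigma * (dR + 1) <= L - 1 ->
  lipschitz_maps L (path_map qs).
Proof.
move=> c sL x y; have L0 : 0 <= L.
  rewrite -[L](subrK 1) addr_ge0 //; apply: le_trans sL.
  by rewrite mulr_ge0 ?addr_ge0 // ltW.
apply/rV_normB_leP; first by rewrite mulr_ge0.
move=> i; rewrite !mxE /clip; set D := `|val x - val y|; have D0 : 0 <= D by exact: normr_ge0.
apply: dist_max; first by rewrite subrr normr0 mulr_ge0.
apply: dist_min; first by rewrite subrr normr0 mulr_ge0.
rewrite opprD addrACA -mulrBr; apply: le_trans (ler_normD _ _) _.
rewrite normrM gtr0_norm //.
have h1 := rV_normB_coord (val x) (val y) i.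
have h2 := field_lip (val x) (val y) i c.
have h3 : sigma * `|field qs (val x) i - field qs (val y) i| <= sigma * ((dR + 1) * D).
  by rewrite ler_wpM2l // ltW.
have h4 : sigma * ((dR + 1) * D) <= (L - 1) * D.
  by rewrite mulrA ler_wpM2r // /D.
apply: le_trans (lerD h1 (le_trans h3 h4)) _; rewrite -/D; lra.
Qed.

Lemma field_low qs x i : w <= offset qs x ord0 i - w \/
    (2 * dR + 1) * w + w <= `|offset qs x| \/
    coord_sum (last origin qs) + w <= coord_sum (x ord0) -> field qs x i = - w.
Proof.
move=> H; apply/max_idPl; rewrite !ge_min.
case: H => [H|[H|H]]; apply/orP; right; apply/orP; [left; lra|right..].
  by apply/orP; left; lra.
by apply/orP; right; lra.
Qed.

Lemma field_high qs x i : offset qs x ord0 i <= 0 -> `|offset qs x| <= 2 * dR * w ->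
  coord_sum (x ord0) + w <= coord_sum (last origin qs) -> field qs x i = w.
Proof.
have w1 := w0; move=> h1 h2 h3; rewrite /field [X in Num.max _ X]min_l.
  by apply/max_idPr; lra.
by rewrite !le_min; apply/and3P; split; lra.
Qed.

Lemma clip_down (a b eps : R) : 0 <= a <= 1 -> 0 < eps -> eps < a -> eps < b ->
  `|clip (a - b) - a| <= eps -> False.
Proof.
move=> a01 e0 ea eb; rewrite ler_norml /clip.
by rewrite /Num.min; case: ltP => ?; rewrite /Num.max; case: ltP => ?; lra.
Qed.

Lemma clip_up (a b eps : R) : 0 <= a <= 1/2 -> 0 < eps < 1/2 -> eps < b ->
  `|clip (a + b) - a| <= eps -> False.
Proof.
move=> a01 e0 eb; rewrite ler_norml /clip.
by rewrite /Num.min; case: ltP => ?; rewrite /Num.max; case: ltP => ?; lra.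
Qed.

(** The offsets sum to zero up to the end of the path and to a nonnegative number beyond it. Hence
    some coordinate is not ahead before the end, and a very negative offset forces a large positive
    one. *)
Lemma offset_sum qs x : chain origin qs -> 0 <= coord_sum (x ord0) ->
  \sum_i offset qs x ord0 i = coord_sum (x ord0) - Num.min (coord_sum (x ord0)) (coord_sum (last origin qs)).
Proof.
move=> c s0; under eq_bigr do rewrite mxE.
rewrite sumrB sum_travel // [coord_sum origin]big1 // (min_r s0) subr0 //.
Qed.

(** Away from the end some coordinate moves by more than [eps]: beyond the end or outside the tube
    one decreases, and inside the tube a coordinate that is not ahead increases. The bound 1 / 2 on
    the end leaves room for this increase before clipping. *)
Lemma path_map_fixed qs (eps : R) (x : cube R d) : chain origin qs -> sigma <= 1 ->
  (forall i, last origin qs i <= 1 / 2) -> 0 < eps < 1 / 2 -> w * sigma = 2 * dR * eps ->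
  approx_fixed_point eps (path_map qs) x ->
  forall i, `|val x ord0 i - last origin qs i| < (2 * dR + 4) * w.
Proof.
have w1 := w0; have sigma1 := sigma0; move=> c s1 lh eh ws Hfix.
have d1 : 1 <= dR by rewrite ler1n.
have {Hfix}fx i : `|clip (val x ord0 i + sigma * field qs (val x) i) - val x ord0 i| <= eps.
  have e0 : 0 <= eps by lra.
  by have := (rV_normB_leP _ _ e0).1 Hfix i; rewrite [val (path_map qs x)]/= mxE.
have x01 i := cube_valP x i.
have s0 : 0 <= coord_sum (val x ord0) by apply: sumr_ge0 => i _; case/andP: (x01 i).
have o0 : @coord_sum R d origin = 0 by rewrite /coord_sum big1.
have path0 i : 0 <= travel origin qs (coord_sum (val x ord0)) i.
  have := @travel_mono _ _ origin qs _ _ i c s0.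
  by rewrite (travel_before (s := 0)) // o0.
have pathl i : travel origin qs (coord_sum (val x ord0)) i <= last origin qs i.
  pose t := Num.max (coord_sum (val x ord0)) (coord_sum (last origin qs)).
  have := @travel_after _ _ origin qs t i c; rewrite subr0 => <-; last first.
    by rewrite le_max lexx orbT.
  by apply: travel_mono => //; rewrite le_max lexx.
have we : 2 * eps <= w.
  have : w * sigma <= w by rewrite ler_piMr // ltW.
  rewrite ws; have : 2 * 1 * eps <= 2 * dR * eps by rewrite ler_wpM2r ?ler_pM2l //; lra.
  by lra.
have wd : 2 * eps * dR <= w.
  have : w * sigma <= w by rewrite ler_piMr // ltW.
  by rewrite ws; lra.
have swe : eps < sigma * w.
  rewrite mulrC ws; have : 2 * 1 * eps <= 2 * dR * eps by rewrite ler_wpM2r ?ler_pM2l //; lra.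
  by lra.
have down i : field qs (val x) i = - w -> eps < val x ord0 i -> False.
  move=> fi xi; have := fx i; rewrite fi mulrN; apply: clip_down => //; lra.
case: (leP (coord_sum (last origin qs) + w) (coord_sum (val x ord0))) => [far|near].
  exfalso; have l0 : 0 <= coord_sum (last origin qs).
    by rewrite -[X in X <= _]o0; apply: coord_sum_le => i; exact: (@chain_le _ _ origin qs i c).
  suff [i xi] : exists i, eps < val x ord0 i.
    by apply: (down i) => //; apply: field_low; right; right.
  (* Otherwise the coordinate sum would be at most d eps <= w / 2, while it is at least w here. *)
  apply: contrapT => no; have : coord_sum (val x ord0) <= \sum_(i < d) eps.
    apply: ler_sum => i _; rewrite leNgt; apply/negP => lt; apply: no; by exists i.
  rewrite sumr_const card_ord -mulr_natr; lra.
case: (leP `|offset qs (val x)| (2 * dR * w)) => [inside|outside]; last first.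
  exfalso; suff [i oi] : exists i, 2 * w <= offset qs (val x) ord0 i.
    apply: (down i); first by apply: field_low; left; lra.
    by move: oi; rewrite mxE; have := path0 i; lra.
  apply: contrapT => no.
  have small i : offset qs (val x) ord0 i < 2 * w.
    by rewrite ltNge; apply/negP => H; apply: no; exists i.
  have sum0 : 0 <= \sum_i offset qs (val x) ord0 i.
    by rewrite offset_sum // subr_ge0 ge_min lexx.
  move: outside; apply/negP; rewrite -leNgt; apply/rV_norm_leP; first by rewrite !mulr_ge0 // ltW.
  move=> i; rewrite ler_norml; apply/andP; split; last first.
    apply: le_trans (ltW (small i)) _.
    have : 2 * 1 * w <= 2 * dR * w by rewrite ler_wpM2r ?ler_pM2l // ltW.
    by lra.
  (* The sum is nonnegative and the other offsets are below 2 w, which bounds this one from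
     below. *)
  have : \sum_j offset qs (val x) ord0 j <=
      \sum_(j < d) ((if j == i then offset qs (val x) ord0 j - 2 * w else 0) + 2 * w).
    by apply: ler_sum => j _; case: ifP => _; [|have := ltW (small j)]; lra.
  rewrite big_split /= -big_mkcond /= big_pred1_eq sumr_const card_ord -mulr_natr; lra.
case: (leP (coord_sum (val x ord0) + w) (coord_sum (last origin qs))) => [before|atend].
  exfalso; suff [i oi] : exists i, offset qs (val x) ord0 i <= 0.
    have := fx i; rewrite field_high //; apply: clip_up; [|lra|lra].
    have := x01 i; have := pathl i; have := lh i; move: oi; rewrite mxE; lra.
  apply: contrapT => no.
  have pos i : 0 < offset qs (val x) ord0 i.
    by rewrite ltNge; apply/negP => H; apply: no; exists i.
  have := offset_sum c s0; rewrite min_l; last by lra.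
  rewrite subrr => e; have := pos (Ordinal d0); move: e.
  rewrite (bigD1 (Ordinal d0)) //=.
  have : 0 <= \sum_(i < d | i != Ordinal d0) offset qs (val x) ord0 i.
    by apply: sumr_ge0 => i _; apply: ltW.
  lra.
(* What remains: 2 d w from the tube, plus w along the path to its end. *)
move=> i; have := rV_norm_coord (offset qs (val x)) i; rewrite [X in `|X|]mxE => h1.
have h2 := @travel_lip _ _ origin qs (coord_sum (val x ord0)) (coord_sum (last origin qs)) i c.
have h3 : `|coord_sum (val x ord0) - coord_sum (last origin qs)| < w.
  by rewrite ltr_norml; apply/andP; split; lra.
rewrite (travel_after (s := coord_sum (last origin qs)) i c) // subr0 in h2.
have h4 := le_trans h1 inside; have h5 := le_lt_trans h2 h3.
move: h4 h5; rewrite ler_norml !ltr_norml => /andP[? ?] /andP[? ?].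
by apply/andP; split; lra.
Qed.

(** If [x] precedes the end of [qs] by at least w, the position of the end is hidden by the minimum
    with w. Otherwise, for each of the two paths, [x] is either beyond its end by w, or (2 d + 4) w
    away from a path point whose time differs by at most w, hence outside the tube; both fields are
    then - w. *)
Lemma path_map_local qs rs (x : cube R d) : chain origin (qs ++ rs) ->
  ~ meets ((2 * dR + 4) * w) (val x ord0) (last origin qs) rs ->
  path_map (qs ++ rs) x = path_map qs x.
Proof.
have w1 := w0; move=> c no; have [cq cr] := (chain_cat _ _ _).1 c.
set s := coord_sum (val x ord0).
have S1S : coord_sum (last origin qs) <= coord_sum (last origin (qs ++ rs)).
  by rewrite last_cat; apply: coord_sum_le => i; apply: chain_le.
set S1 := coord_sum (last origin qs) in S1S *.
set S := coord_sum (last origin (qs ++ rs)) in S1S *.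
have away t : S1 <= t <= S -> exists i,
    (2 * dR + 4) * w <= `|val x ord0 i - travel origin (qs ++ rs) t i|.
  move=> /andP[t1 t2]; apply: contrapT => no'; apply: no; exists t.
  split; first by rewrite t1 /S last_cat in t2 *.
  move=> i; rewrite ltNge; apply/negP => H; apply: no'; exists i.
  by rewrite travel_cat (travel_after i cq) // subr0.
suff fE i : field (qs ++ rs) (val x) i = field qs (val x) i.
  by apply/val_inj/rowP => i; rewrite !mxE fE.
case: (leP s (S1 - w)) => [early|late].
  have tE j : travel origin (qs ++ rs) s j = travel origin qs s j.
    by rewrite travel_cat (@travel_before _ _ _ rs) ?addr0 // -/S1; lra.
  have oE : offset (qs ++ rs) (val x) = offset qs (val x).
    by apply/rowP => j; rewrite !mxE tE.
  rewrite /field oE -/S1 -/S -/s; move: (w - _) (_ - `|_|) => a b.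
  by rewrite ![Num.min a _]minA ![Num.min w _]minCA -!minA; congr Num.max;
    rewrite !(min_l (x := w)) ?(min_l (x := w)) //; lra.
have far ps t : chain origin ps -> `|s - t| <= w ->
    (exists i, (2 * dR + 4) * w <= `|val x ord0 i - travel origin ps t i|) ->
    (2 * dR + 1) * w + w <= `|offset ps (val x)|.
  move=> cp st [j Hj]; apply: le_trans (rV_norm_coord _ j); rewrite mxE -/s.
  have := @travel_lip _ _ origin ps s t j cp.
  have := ler_distD (travel origin ps s j) (val x ord0 j) (travel origin ps t j); lra.
rewrite !field_low //.
  case: (leP (S1 + w) s) => [|lt]; first by right; right.
  right; left; apply: (far qs S1) => //; first by rewrite ler_norml; apply/andP; split; lra.
  have [|j Hj] := away S1; first by rewrite lexx S1S.
  by exists j; rewrite travel_cat (@travel_before _ _ _ rs) ?addr0 // in Hj.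
case: (leP (S + w) s) => [|lt]; first by right; right.
(* The time [s] clamped to the range of the added part of the path. *)
right; left; apply: (far _ (Num.max S1 (Num.min s S))) => //.
  by rewrite ler_norml /Num.min; case: ltP => ?; rewrite /Num.max; case: ltP => ?; apply/andP; split; lra.
apply: away; rewrite /Num.min; case: ltP => ?; rewrite /Num.max; case: ltP => ?; apply/andP; split; lra.
Qed.

End HiddenPath.

(** * Random paths *)

(** Half the side of a box, in grid units. A point stays in the lower half of its box and the next
    one lies in the upper half, so that the points form a chain. *)
Fixpoint hgt (ms : seq nat) : nat := if ms is m :: ms' then (2 * m * hgt ms')%N else 1%N.

Lemma hgt_gt0 ms : all (leq 1) ms -> (0 < hgt ms)%N.
Proof. by elim: ms => //= m ms IH /andP[m0 /IH h0]; rewrite !muln_gt0 m0 h0. Qed.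

(** Source of the constants 3 and 9 below: in one coordinate a given value is close to at most three
    boxes of a level, and to at most three grid points in each. *)
Lemma sum_clustered (R : realType) (m : nat) (P : pred 'I_m) :
  (forall a b, P a -> P b -> (b < a + 3)%N) -> \sum_a (P a)%:R <= 3 :> R.
Proof.
move=> H; have -> : \sum_a (P a)%:R = #|P|%:R :> R.
  by rewrite -sum1_card natr_sum [RHS]big_mkcond /=; apply: eq_bigr => a _; rewrite unfold_in; case: (P a).
rewrite ler_nat; case: (pickP P) => [a0 Pa0|P0]; last by rewrite eq_card0.
case: (arg_minnP (fun a : 'I_m => a : nat) Pa0) => a Pa amin.
rewrite -[leqRHS](card_ord 3); pose f (b : 'I_m) : 'I_3 := inord (b - a).
rewrite -(@card_in_image _ _ f); first exact: max_card.
move=> b c Pb Pc /(congr1 val) /=; have := H _ _ Pa Pb; have := H _ _ Pa Pc.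
have := amin _ Pb; have := amin _ Pc => ab ac h1 h2; rewrite !inordK; [|lia..].
by move=> e; apply/val_inj => /=; lia.
Qed.

Section RandomChains.
Variables (R : realType) (d : nat) (rho : R).
Hypothesis rho0 : 0 < rho.
Notation pt := ('I_d -> nat).
Notation vec := ('I_d -> R).
Implicit Types (ms : seq nat) (b : pt) (x : vec) (l : seq vec) (f g : seq vec -> R).

Section Level.
Variables (b : pt) (m : nat) (ms : seq nat).
Notation digits := ('I_m * 'I_(hgt ms))%type.

Definition sub_coord (i : 'I_d) (a : 'I_m) : nat := (b i + hgt (m :: ms) + 2 * hgt ms * a)%N.
Definition sub_corner (o : {ffun 'I_d -> digits}) : pt := fun i => sub_coord i (o i).1.
Definition sub_point (o : {ffun 'I_d -> digits}) : vec :=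
  fun i => rho * (sub_coord i (o i).1 + (o i).2)%:R.

Lemma sub_corner_ge o i : (b i + hgt (m :: ms) <= sub_corner o i)%N.
Proof. by rewrite leq_addr. Qed.

Lemma sub_corner_le o i : (sub_corner o i + 2 * hgt ms <= b i + 2 * hgt (m :: ms))%N.
Proof.
clear rho0; rewrite /sub_corner /sub_coord /=; set h := hgt ms.
have := ltn_ord (o i).1; set a := nat_of_ord _ => am.
have : (h * a.+1 <= h * m)%N by rewrite leq_mul2l am orbT.
by nia.
Qed.

Lemma sub_point_ge o i : rho * (b i + hgt (m :: ms))%:R <= sub_point o i.
Proof.
rewrite ler_wpM2l ?(ltW rho0) // ler_nat; apply: leq_trans (leq_addr _ _); exact: sub_corner_ge.
Qed.

Lemma sub_point_le o i : sub_point o i <= rho * (sub_corner o i + hgt ms)%:R.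
Proof.
by rewrite ler_wpM2l ?(ltW rho0) // ler_nat leq_add2l ltnW.
Qed.

End Level.

(* The expectation of [f (p_1 :: ... :: p_k)] for nested random boxes: a box
   with corner [b] and side [2 * hgt ms] contains, in its upper half, [m ^ d]
   boxes of side [2 * hgt ms'], one of which is chosen uniformly, and the point
   is uniform among the grid points of the lower half of the chosen box. *)
Fixpoint avg ms b f : R :=
  if ms is m :: ms' then
    ((m * hgt ms') ^ d)%:R^-1 *
    \sum_(o : {ffun 'I_d -> 'I_m * 'I_(hgt ms')})
      avg ms' (sub_corner b o) (fun l => f (sub_point b o :: l))
  else f [::].

Lemma avg_cons m ms b f : avg (m :: ms) b f = ((m * hgt ms) ^ d)%:R^-1 *
  \sum_(o : {ffun 'I_d -> 'I_m * 'I_(hgt ms)})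
    avg ms (sub_corner b o) (fun l => f (sub_point b o :: l)).
Proof. by []. Qed.

Fixpoint supp ms b l : Prop :=
  match ms, l with
  | [::], [::] => True
  | m :: ms', p :: l' => exists o : {ffun 'I_d -> 'I_m * 'I_(hgt ms')},
      p = sub_point b o /\ supp ms' (sub_corner b o) l'
  | _, _ => False
  end.

Lemma avg_le ms b f g : (forall l, supp ms b l -> f l <= g l) -> avg ms b f <= avg ms b g.
Proof.
elim: ms b f g => [|m ms IH] b f g H /=; first exact: H.
rewrite ler_wpM2l ?invr_ge0 //; apply: ler_sum => o _; apply: IH => l Hl; apply: H.
by exists o.
Qed.

Lemma avgD ms b f g : avg ms b (fun l => f l + g l) = avg ms b f + avg ms b g.
Proof.
elim: ms b f g => [//|m ms IH] b f g /=; rewrite -mulrDr -big_split /=; congr (_ * _).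
by apply: eq_bigr => o _; rewrite IH.
Qed.

Lemma avgM ms b c f : avg ms b (fun l => c * f l) = c * avg ms b f.
Proof.
elim: ms b f => [//|m ms IH] b f /=; rewrite mulrCA; congr (_ * _); rewrite mulr_sumr.
by apply: eq_bigr => o _; rewrite IH.
Qed.

Lemma card_digits m ms : #|{ffun 'I_d -> 'I_m * 'I_(hgt ms)}| = ((m * hgt ms) ^ d)%N.
Proof. by rewrite card_ffun card_prod !card_ord. Qed.

Lemma avg_cst ms b (c : R) : all (leq 1) ms -> avg ms b (fun=> c) = c.
Proof.
elim: ms b => [//|m ms IH] b /= /andP[m0 ms0].
rewrite (eq_bigr (fun=> c)) => [|o _]; last exact: IH.
rewrite sumr_const card_digits -[c *+ _]mulr_natl mulKf //.
by rewrite pnatr_eq0 -lt0n expn_gt0 muln_gt0 m0 hgt_gt0.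
Qed.

Lemma avg_sum (T : Type) (s : seq T) ms b (f : T -> seq vec -> R) : all (leq 1) ms ->
  avg ms b (fun l => \sum_(t <- s) f t l) = \sum_(t <- s) avg ms b (f t).
Proof.
move=> ms0; elim: s => [|t s IH].
  by rewrite big_nil -[RHS](avg_cst b 0 ms0); congr avg; apply/funext => l; rewrite big_nil.
rewrite big_cons -IH -avgD; congr avg; apply/funext => l; by rewrite big_cons.
Qed.

Lemma supp_chain ms b l p : (forall i, p i <= rho * (b i + hgt ms)%:R) -> supp ms b l -> chain p l.
Proof.
elim: ms b l p => [|m ms IH] b [|q l] p //= pb [om [-> Hl]]; split.
  by move=> i; apply: le_trans (pb i) _; apply: sub_point_ge.
by apply: IH Hl => i; apply: sub_point_le.
Qed.

Lemma supp_tail_chain m ms b p l : supp (m :: ms) b (p :: l) -> chain p l.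
Proof. by case=> om [-> sl]; apply: supp_chain sl; exact: sub_point_le. Qed.

Lemma supp_size ms b l : supp ms b l -> size l = size ms.
Proof. by elim: ms b l => [|m ms IH] b [|p l] //= [om [_ /IH ->]]. Qed.

Lemma supp_bounded ms b l p i : p i <= rho * (b i + 2 * hgt ms)%:R -> supp ms b l ->
  last p l i <= rho * (b i + 2 * hgt ms)%:R.
Proof.
elim: ms b l p => [|m ms IH] b [|q l] p //= pb [om [-> Hl]].
have H : rho * (sub_corner b om i + 2 * hgt ms)%:R <= rho * (b i + 2 * hgt (m :: ms))%:R.
  by rewrite ler_wpM2l ?(ltW rho0) // ler_nat sub_corner_le.
apply: le_trans H; apply: IH Hl; apply: le_trans (sub_point_le _ _ _) _.
by rewrite ler_wpM2l ?(ltW rho0) // ler_nat leq_add2l leq_pmull.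
Qed.

Definition near (z : R) (n : nat) : bool := `|z - rho * n%:R| < rho.
Definition near_itv (z : R) (n k : nat) : bool := (rho * n%:R - rho < z < rho * (n + k)%:R + rho).

Lemma near_itv_sub z n k n' k' : (n <= n')%N -> (n' + k' <= n + k)%N ->
  near_itv z n' k' -> near_itv z n k.
Proof.
rewrite /near_itv => h1 h2 /andP[h3 h4]; apply/andP; split.
  by apply: le_lt_trans h3; rewrite lerD2r ler_wpM2l ?(ltW rho0) // ler_nat.
by apply: lt_le_trans h4 _; rewrite lerD2r ler_wpM2l ?(ltW rho0) // ler_nat.
Qed.

Lemma near_near_itv z n : near z n -> near_itv z n 0.
Proof. by rewrite /near /near_itv addn0 ltr_distl. Qed.

Lemma sum_near z A h : \sum_(u < h) (near z (A + u))%:R <= 3 :> R.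
Proof.
apply: sum_clustered => u v; rewrite /near !ltr_distl => /andP[h1 h2] /andP[h3 h4].
have : rho * (A + v)%:R < rho * (A + u + 2)%:R.
  rewrite [in ltRHS]natrD mulrDr; lra.
by rewrite ltr_pM2l // ltr_nat; lia.
Qed.

Lemma sum_near_itv z A h m : (0 < h)%N ->
  \sum_(a < m) (near_itv z (A + 2 * h * a) (2 * h))%:R <= 3 :> R.
Proof.
move=> h0; apply: sum_clustered => a a'; rewrite /near_itv => /andP[h1 h2] /andP[h3 h4].
have : rho * (A + 2 * h * a')%:R < rho * (A + 2 * h * a + 2 * h + 2)%:R.
  rewrite [in ltRHS]natrD mulrDr; lra.
by rewrite ltr_pM2l // ltr_nat; nia.
Qed.

Lemma sum_digits_itv b m ms i z : (0 < hgt ms)%N ->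
  \sum_(a : 'I_m * 'I_(hgt ms)) (near_itv z (sub_coord b ms i a.1) (2 * hgt ms))%:R
    <= 3 * (hgt ms)%:R :> R.
Proof.
move=> h0; rewrite -(pair_bigA _ (fun (a : 'I_m) (u : 'I_(hgt ms)) =>
  (near_itv z (sub_coord b ms i a) (2 * hgt ms))%:R)) /=.
under eq_bigr do rewrite sumr_const card_ord -[_ *+ hgt ms]mulr_natr.
by rewrite -mulr_suml ler_wpM2r // sum_near_itv.
Qed.

Lemma sum_digits_near b m ms i z : (0 < hgt ms)%N ->
  \sum_(a : 'I_m * 'I_(hgt ms)) (near z (sub_coord b ms i a.1 + a.2))%:R <= 9 :> R.
Proof.
move=> h0; rewrite -(pair_bigA _ (fun (a : 'I_m) (u : 'I_(hgt ms)) =>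
  (near z (sub_coord b ms i a + u))%:R)) /=.
have -> : 9 = 3 * 3 :> R by ring.
apply: (@le_trans _ _ (\sum_(a < m) (near_itv z (sub_coord b ms i a) (2 * hgt ms))%:R * 3)).
  apply: ler_sum => a _; case: (boolP (near_itv _ _ _)) => [_|no] /=.
    by rewrite mul1r sum_near.
  rewrite mul0r big1 // => u _; case: (boolP (near _ _)) => // /near_near_itv H.
  case/negP: no; apply: near_itv_sub H; first exact: leq_addr.
  by rewrite addn0 leq_add2l (leq_trans (ltnW (ltn_ord u))) // leq_pmull.
by rewrite -mulr_suml ler_wpM2r // sum_near_itv.
Qed.

(** The part of the path before the first point of [l] is left out, since that point is revealed
    after the round in any case. *)
Definition hits x l : Prop := if l is p :: l' then meets rho x p l' else False.

Lemma meets_supp_itv ms b l x p i :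
  (forall i, rho * (b i)%:R <= p i) -> (forall i, p i <= rho * (b i + hgt ms)%:R) ->
  supp ms b l -> meets rho x p l -> near_itv (x i) (b i) (2 * hgt ms).
Proof.
move=> pb1 pb2 sl [s [/andP[s1 s2] H]]; have c := supp_chain pb2 sl.
have := H i; rewrite ltr_distl => /andP[h1 h2].
have t0 : 0 <= travel p l s i.
  by have := @travel_mono _ _ p l _ _ i c s1; rewrite (travel_before _ _ (lexx _)).
have t1 : p i + travel p l s i <= last p l i.
  have := @travel_mono _ _ p l _ _ i c s2; rewrite (travel_after _ _ (lexx _)) //; lra.
have t2 : last p l i <= rho * (b i + 2 * hgt ms)%:R.
  apply: supp_bounded sl; apply: le_trans (pb2 i) _.
  by rewrite ler_wpM2l ?(ltW rho0) // ler_nat leq_add2l leq_pmull.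
have t3 := pb1 i.
by rewrite /near_itv; apply/andP; split; lra.
Qed.

(** A product of these over the coordinates bounds the indicator of meeting leg [j], so that the sum
    over all choices of digits factorizes. Coordinate [j] is only confined to the box; the smaller
    ones are pinned to the end of the leg, the larger ones to its start. *)
Definition leg_factor b m m2 ms x (j i : 'I_d) (a : 'I_m * 'I_(hgt (m2 :: ms)))
    (a2 : 'I_m2 * 'I_(hgt ms)) : R :=
  if (i < j)%N then
    (near_itv (x i) (sub_coord b (m2 :: ms) i a.1) (2 * hgt (m2 :: ms)))%:R *
    (near (x i) (sub_coord (fun=> sub_coord b (m2 :: ms) i a.1) ms i a2.1 + a2.2))%:R
  else if i == j then
    (near_itv (x i) (sub_coord b (m2 :: ms) i a.1) (2 * hgt (m2 :: ms)))%:R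
  else (near (x i) (sub_coord b (m2 :: ms) i a.1 + a.2))%:R.

Lemma leg_factor_ge0 b m m2 ms x j i (a : 'I_m * _) a2 : 0 <= @leg_factor b m m2 ms x j i a a2.
Proof. by rewrite /leg_factor; case: ifP => _; [|case: ifP => _]; rewrite ?mulr_ge0. Qed.

(** The constant is 54 = 3 * 9 * 2: three boxes for the first point, nine choices for the second,
    and the factor 2 in [hgt (m2 :: ms)]. *)
Lemma leg_factor_sum b m m2 ms x j i : all (leq 1) (m2 :: ms) ->
  \sum_(a : 'I_m * _) \sum_a2 @leg_factor b m m2 ms x j i a a2 <=
  (if i == j then (hgt (m2 :: ms))%:R else 1) * (54 * (m2 * hgt ms)%:R).
Proof.
move=> ms0; have h0 := hgt_gt0 ms0; have /andP[m20 ms0'] : (0 < m2)%N && all (leq 1) ms := ms0.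
have h20 := hgt_gt0 ms0'; set W : R := (m2 * hgt ms)%:R.
have W0 : 0 <= W by [].
have h1 : 1 <= (hgt (m2 :: ms))%:R :> R by rewrite ler1n.
have hW : (hgt (m2 :: ms))%:R = 2 * W :> R by rewrite /W -natrM /= mulnA.
have cW : (#|{: 'I_m2 * 'I_(hgt ms)}|%:R : R) = W by rewrite card_prod !card_ord.
rewrite /leg_factor; case: ltnP => ij.
  have -> : (i == j) = false by apply/negbTE; rewrite neq_ltn ij.
  rewrite mul1r; under eq_bigr do rewrite -mulr_sumr.
  apply: (@le_trans _ _ (\sum_(a : 'I_m * 'I_(hgt (m2 :: ms)))
    (near_itv (x i) (sub_coord b (m2 :: ms) i a.1) (2 * hgt (m2 :: ms)))%:R * 9)).
    by apply: ler_sum => a _; rewrite ler_wpM2l // sum_digits_near.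
  rewrite -mulr_suml; have := sum_digits_itv b m i (x i) h0; lra.
case: eqVneq => [_|ne].
  under eq_bigr do rewrite sumr_const -[_ *+ _]mulr_natr cW.
  rewrite -mulr_suml; have := sum_digits_itv b m i (x i) h0.
  set S := \sum_a _ => HS; have : S * W <= 3 * (hgt (m2 :: ms))%:R * W by rewrite ler_wpM2r.
  have : 0 <= (hgt (m2 :: ms))%:R * W by rewrite mulr_ge0.
  lra.
under eq_bigr do rewrite sumr_const -[_ *+ _]mulr_natr cW.
rewrite -mulr_suml mul1r; have := sum_digits_near b m i (x i) h0.
set S := \sum_a _ => HS; have : S * W <= 9 * W by rewrite ler_wpM2r.
lra.
Qed.

Lemma meets_leg_factor b m m2 ms x j (o1 : {ffun 'I_d -> 'I_m * 'I_(hgt (m2 :: ms))})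
    (o2 : {ffun 'I_d -> 'I_m2 * 'I_(hgt ms)}) :
  (`[< meets_leg rho x (sub_point b o1) (sub_point (sub_corner b o1) o2) j >])%:R <=
  \prod_i @leg_factor b m m2 ms x j i (o1 i) (o2 i).
Proof.
case: asboolP => [H|_]; last first.
  by apply: prodr_ge0 => i _; exact: leg_factor_ge0.
rewrite big1 // => i _; have := H i; rewrite /leg_factor.
have itv k : (k <= hgt (m2 :: ms))%N -> near (x i) (sub_corner b o1 i + k) ->
    near_itv (x i) (sub_corner b o1 i) (2 * hgt (m2 :: ms)).
  move=> kh /near_near_itv; apply: near_itv_sub; first exact: leq_addr.
  by rewrite addn0 leq_add2l (leq_trans kh) // leq_pmull.
case: ifP => ij.
  move=> Hi; rewrite [near _ _](_ : _ = true) // mulr1.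
  suff -> : near_itv (x i) (sub_coord b (m2 :: ms) i (o1 i).1) (2 * hgt (m2 :: ms)) by [].
  move: Hi => /near_near_itv; apply: near_itv_sub.
    apply: leq_trans (leq_addr _ _); apply: leq_trans (sub_corner_ge (sub_corner b o1) o2 i).
    exact: leq_addr.
  rewrite addn0; have := sub_corner_le (sub_corner b o1) o2 i; apply: leq_trans.
  by rewrite leq_add2l (leq_trans (ltnW (ltn_ord _))) // leq_pmull.
case: eqVneq => [ei|ne] Hi; last by rewrite [near _ _](_ : _ = true).
rewrite [near_itv _ _ _](_ : _ = true) //; case/andP: Hi => h1 h2; apply/andP; split.
  apply: le_lt_trans h1; rewrite lerD2r ler_wpM2l ?(ltW rho0) // ler_nat; exact: leq_addr.
apply: lt_le_trans h2 _; rewrite lerD2r ler_wpM2l ?(ltW rho0) // ler_nat.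
apply: leq_trans (sub_corner_le (sub_corner b o1) o2 i).
by rewrite leq_add2l (leq_trans (ltnW (ltn_ord _))) // leq_pmull.
Qed.

(** Only the free coordinate contributes a factor [hgt (m2 :: ms)], which makes the probability a
    side divided by a volume. *)
Lemma avg_meets_leg b m m2 ms x : all (leq 1) (m :: m2 :: ms) ->
  avg (m :: m2 :: ms) b (fun l => if l is p :: q :: _ then
     \sum_j (`[< meets_leg rho x p q j >])%:R else 0) <=
  d%:R * 54 ^+ d * (hgt (m2 :: ms))%:R / ((m * hgt (m2 :: ms)) ^ d)%:R.
Proof.
move=> ms0; have /andP[m0 ms0'] : (0 < m)%N && all (leq 1) (m2 :: ms) := ms0.
have /andP[m20 ms0''] : (0 < m2)%N && all (leq 1) ms := ms0'.
have h20 := hgt_gt0 ms0''; pose W : R := (m2 * hgt ms)%:R.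
have W0 : 0 < W ^+ d by rewrite exprn_gt0 // ltr0n muln_gt0 m20.
rewrite [avg _ _ _]/= mulrC ler_wpM2r ?invr_ge0 // -/(hgt (m2 :: ms)).
under eq_bigr => o1 _ do under eq_bigr => o2 _ do rewrite avg_cst //.
rewrite -mulr_sumr natrX -/W ler_pdivrMl //.
under eq_bigr do rewrite exchange_big /=.
rewrite exchange_big /=.
apply: (@le_trans _ _ (\sum_(j < d) (hgt (m2 :: ms))%:R * (54 * W) ^+ d)); last first.
  rewrite sumr_const card_ord -[_ *+ d]mulr_natr exprMn.
  by rewrite /= le_eqVlt; apply/orP; left; apply/eqP; ring.
apply: ler_sum => j _.
apply: (@le_trans _ _ (\sum_(o1 : {ffun 'I_d -> 'I_m * 'I_(hgt (m2 :: ms))})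
    \sum_(o2 : {ffun 'I_d -> 'I_m2 * 'I_(hgt ms)})
      \prod_i @leg_factor b m m2 ms x j i (o1 i) (o2 i))).
  by apply: ler_sum => o1 _; apply: ler_sum => o2 _; exact: meets_leg_factor.
under eq_bigr do rewrite -(bigA_distr_bigA (fun i a2 => leg_factor _ _ j i _ a2)).
rewrite -(bigA_distr_bigA (fun i a => \sum_a2 @leg_factor b m m2 ms x j i a a2)).
apply: (@le_trans _ _ (\prod_(i < d) ((if i == j then (hgt (m2 :: ms))%:R else 1) * (54 * W)))).
  apply: ler_prod => i _; rewrite leg_factor_sum // andbT.
  by apply: sumr_ge0 => a _; apply: sumr_ge0 => a2 _; exact: leg_factor_ge0.
rewrite big_split /= prodr_const card_ord -big_mkcond /= big_pred1_eq //.
Qed.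

(** In [avg_hits], the term with 54 pays for the first leg, the 6 for choosing a box close to the
    query, and the 9 for a path reduced to one point. *)
Fixpoint hit_cst (n : nat) : R :=
  if n is n'.+1 then d%:R * 54 ^+ d + 6 ^+ d * hit_cst n' else 9 ^+ d.

Lemma hit_cst_ge0 n : 0 <= hit_cst n.
Proof. by elim: n => [|n IH] /=; rewrite ?addr_ge0 ?mulr_ge0 ?exprn_ge0. Qed.

Lemma hits_itv b m ms x (o : {ffun 'I_d -> 'I_m * 'I_(hgt ms)}) l i :
  supp ms (sub_corner b o) l -> hits x l -> near_itv (x i) (sub_corner b o i) (2 * hgt ms).
Proof.
case: ms o l => [|m2 ms] o [|q l] //= [om [-> sl]] H.
have := @meets_supp_itv ms _ l x _ i _ (sub_point_le _ om) sl H.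
move=> /(_ _); have Hge k : rho * (sub_corner (sub_corner b o) om k)%:R <= sub_point (sub_corner b o) om k.
  by rewrite ler_wpM2l ?(ltW rho0) // ler_nat leq_addr.
move=> /(_ Hge); apply: near_itv_sub; last exact: sub_corner_le.
by apply: leq_trans (sub_corner_ge _ _ _); exact: leq_addr.
Qed.

(** The path is split after its first leg. The rest stays in the box of the first point, so it can
    be met only if that box is close to [x] in every coordinate; inside such a box the inductive
    bound applies. *)
Lemma avg_hits b m ms x : (0 < d)%N -> all (leq 1) (m :: ms) ->
  avg (m :: ms) b (fun l => (`[< hits x l >])%:R) <=
  hit_cst (size ms) * (hgt ms)%:R / ((m * hgt ms) ^ d)%:R.
Proof.
move=> d0; elim: ms m b => [|m2 ms IH] m b ms0.
  rewrite /= mulr1 mulrC ler_wpM2r ?invr_ge0 //.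
  apply: (@le_trans _ _ (\sum_(o : {ffun 'I_d -> 'I_m * 'I_1})
      \prod_i (near (x i) (sub_coord b [::] i (o i).1 + (o i).2))%:R)).
    apply: ler_sum => o _; case: asboolP => [/meets_nil H|_]; last first.
      by apply: prodr_ge0.
    rewrite big1 // => i _; have Hi := H i; by rewrite [near _ _](_ : _ = true).
  rewrite -(bigA_distr_bigA (fun i (a : 'I_m * 'I_1) => (near (x i) (sub_coord b [::] i a.1 + a.2))%:R)).
  rewrite -[X in _ <= _ ^+ X]card_ord -prodr_const; apply: ler_prod => i _.
  by rewrite sumr_ge0 //=; exact: (@sum_digits_near b m [::] i (x i) isT).
have /andP[m0 ms0'] : (0 < m)%N && all (leq 1) (m2 :: ms) := ms0.
have /andP[m20 ms0''] : (0 < m2)%N && all (leq 1) ms := ms0'.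
have h20 := hgt_gt0 ms0''; have h0 := hgt_gt0 ms0'.
pose W : R := (m2 * hgt ms)%:R.
have W0 : 0 < W ^+ d by rewrite exprn_gt0 // ltr0n muln_gt0 m20.
apply: (@le_trans _ _ (avg (m :: m2 :: ms) b (fun l => (if l is p :: q :: _ then
     \sum_j (`[< meets_leg rho x p q j >])%:R else 0) + (`[< hits x (behead l) >])%:R))).
  apply: avg_le => l sl; have := supp_size sl; case: l sl => [|p [|q l]] // sl _.
  have c := supp_tail_chain sl.
  case: asboolP => // H; last by rewrite addr_ge0 // sumr_ge0.
  case: (meets_cons d0 c H) => [[j Hj]|H2]; last by rewrite (asboolT H2) lerDr sumr_ge0.
  by rewrite (bigD1 j) //= (asboolT Hj) -addrA lerDl addr_ge0 // sumr_ge0.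
rewrite avgD [hit_cst _]/= !mulrDl; apply: lerD; first exact: avg_meets_leg.
rewrite avg_cons mulrC ler_wpM2r ?invr_ge0 //.
pose D' := hit_cst (size ms) * (hgt ms)%:R / ((m2 * hgt ms) ^ d)%:R.
have D0 : 0 <= D' by rewrite !mulr_ge0 ?invr_ge0 ?hit_cst_ge0.
apply: (@le_trans _ _ (\sum_(o : {ffun 'I_d -> 'I_m * 'I_(hgt (m2 :: ms))})
   (\prod_i (near_itv (x i) (sub_coord b (m2 :: ms) i (o i).1) (2 * hgt (m2 :: ms)))%:R) * D')).
  apply: ler_sum => o _.
  have [/forallP H|/forallPn [i no]] := boolP [forall i,
      near_itv (x i) (sub_coord b (m2 :: ms) i (o i).1) (2 * hgt (m2 :: ms))].
    rewrite big1 ?mul1r; last by move=> i _; rewrite H.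
    exact: (IH m2 (sub_corner b o) ms0').
  rewrite (bigD1 i) //= (negbTE no) !mul0r.
  rewrite -[leRHS](@avg_cst (m2 :: ms) (sub_corner b o) 0 ms0').
  apply: (@avg_le (m2 :: ms) (sub_corner b o) (fun l => (`[< hits x l >])%:R) (fun=> 0)) => l sl.
  case: asboolP => // H; case/negP: no; exact: (@hits_itv b m (m2 :: ms) x o l i sl H).
rewrite -mulr_suml -(bigA_distr_bigA (fun i (a : 'I_m * 'I_(hgt (m2 :: ms))) =>
  (near_itv (x i) (sub_coord b (m2 :: ms) i a.1) (2 * hgt (m2 :: ms)))%:R)).
have hW : (hgt (m2 :: ms))%:R = 2 * W :> R by rewrite /W -natrM /= mulnA.
apply: (@le_trans _ _ ((6 * W) ^+ d * D')).
  rewrite ler_wpM2r // -[X in _ <= _ ^+ X]card_ord -prodr_const; apply: ler_prod => i _.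
  rewrite sumr_ge0 //=; have := @sum_digits_itv b m (m2 :: ms) i (x i) h0; rewrite hW; lra.
rewrite /D' natrX -/W exprMn.
have -> : 6 ^+ d * W ^+ d * (hit_cst (size ms) * (hgt ms)%:R / W ^+ d) =
   6 ^+ d * hit_cst (size ms) * (hgt ms)%:R by field; rewrite lt0r_neq0.
rewrite ler_wpM2l ?mulr_ge0 ?hit_cst_ge0 ?exprn_ge0 // ler_nat.
by rewrite [leqRHS]/= leq_pmull // muln_gt0.
Qed.

End RandomChains.

(** * The lower bound *)

Section Game.
Variables (R : realType) (d : nat) (w sigma eps : R).
Notation vec := ('I_d -> R).
Notation pt := ('I_d -> nat).
Notation origin := (fun=> @GRing.zero R).
Notation dR := (@GRing.natmul R 1 d).
Notation rho := ((2 * dR + 4) * w).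
Hypotheses (d0 : (0 < d)%N) (w0 : 0 < w) (sigma0 : 0 < sigma).
Hypotheses (sigma1 : sigma <= 1) (eps_lt : 0 < eps < 1 / 2).
Hypothesis (wsigma : w * sigma = 2 * dR * eps).

Lemma avg_cons_le m ms b (f : seq vec -> R) c : all (leq 1) (m :: ms) ->
  (forall o : {ffun 'I_d -> 'I_m * 'I_(hgt ms)},
    avg rho ms (sub_corner b o) (fun l => f (sub_point rho b o :: l)) <= c) ->
  avg rho (m :: ms) b f <= c.
Proof.
move=> /andP[m0 ms0] H; rewrite avg_cons; have h0 := hgt_gt0 ms0.
rewrite ler_pdivrMl; last by rewrite ltr0n expn_gt0 muln_gt0 m0 h0.
apply: (@le_trans _ _ (\sum_(o : {ffun 'I_d -> 'I_m * 'I_(hgt ms)}) c)).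
  by apply: ler_sum => o _; exact: H.
by rewrite sumr_const card_digits mulr_natl.
Qed.

Definition wins (T : nat) k (A : algorithm (cube R d) k) (F : cube R d -> cube R d) : Prop :=
  approx_fixed_point eps F (output F A) /\ (query_count F A <= T)%N.

(* One term for each round of at most [T] queries, and a last one for the
   output. *)
Fixpoint game_bound (T : nat) (ms : seq nat) : R :=
  if ms is m :: ms' then
    (if ms' is [::] then 1 else T%:R) *
      (hit_cst R d (size ms') * (hgt ms')%:R / ((m * hgt ms') ^ d)%:R) + game_bound T ms'
  else 0.

Lemma game_bound_ge0 T ms : 0 <= game_bound T ms.
Proof.
elim: ms => [//|m ms IH] /=; rewrite addr_ge0 // mulr_ge0 //; first by case: ms {IH}.
by rewrite !mulr_ge0 ?invr_ge0 ?hit_cst_ge0.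
Qed.

Lemma rho_gt0 : 0 < rho.
Proof. by rewrite mulr_gt0 // addr_gt0 // ?ltr0n // mulr_gt0 // ltr0n. Qed.

(** [pre] holds the points already revealed, so the queries of the round are fixed and a union bound
    with [avg_hits] applies. If none of them meets the path beyond the next point p, the answers are
    those for the path ending at p; the continuation depends on [pre] and p only, and p joins
    [pre]. *)
Lemma avg_wins (T k : nat) (A : algorithm (cube R d) k) ms (b : pt) pre :
  all (leq 1) ms -> size ms = k.+1 -> chain origin pre ->
  (forall i, last origin pre i <= rho * (b i + hgt ms)%:R) ->
  (forall i, rho * (b i + 2 * hgt ms)%:R <= 1 / 2) ->
  avg rho ms b (fun l => (`[< wins T A (path_map w sigma (pre ++ l)) >])%:R) <= game_bound T ms.
Proof.
have r0 := rho_gt0.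
elim: A ms b pre => {k} [x|k qs next IH] [|m ms] // b pre ms0 sz cpre lpre bnd.
  case: ms sz ms0 lpre bnd => // _ ms0 lpre bnd.
  rewrite [game_bound _ _]/= mul1r addr0; apply: le_trans (avg_hits r0 b (val x ord0) d0 ms0).
  apply: (@avg_le _ _ _ [:: m]) => l sl; have := supp_size sl; case: l sl => [|p [|q l]] // sl _.
  (* A correct output lies within [rho] of the last random point, hence hits it like a query. *)
  case: asboolP => [[Hfix _]|//]; rewrite asboolT // /hits; exists (coord_sum p).
  rewrite lexx; split=> // i; rewrite /= addr0.
  have c : chain origin (pre ++ [:: p]) by apply/chain_cat; split=> //; exact: (supp_chain r0 lpre sl).
  have := path_map_fixed d0 w0 sigma0 c sigma1 _ eps_lt wsigma Hfix.
  rewrite last_cat => /(_ _ i); apply=> {}i; apply: le_trans (bnd i).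
  apply: (@supp_bounded _ _ _ r0 [:: m] b [:: p] (last origin pre) i _ sl); apply: le_trans (lpre i) _.
  by rewrite ler_wpM2l ?(ltW r0) // ler_nat leq_add2l leq_pmull.
have sz' : size ms = k.+1 by case: sz.
case: (leqP (size qs) T) => szq; last first.
  apply: (@le_trans _ _ (avg rho (m :: ms) b (fun=> 0))).
    apply: (@avg_le _ _ _ (m :: ms)) => l _; case: asboolP => // -[_ /= H].
    by move: (leq_trans szq (leq_trans (leq_addr _ _) H)); rewrite ltnn.
  by rewrite avg_cst //; exact: (game_bound_ge0 T (m :: ms)).
have ms0' : all (leq 1) ms by case/andP: ms0.
apply: (@le_trans _ _ (avg rho (m :: ms) b (fun l =>
   \sum_(x <- qs) (`[< hits rho (val x ord0) l >])%:R +
   (if l is p :: l' then (`[< wins T (next (map (path_map w sigma (pre ++ [:: p])) qs))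
       (path_map w sigma ((pre ++ [:: p]) ++ l')) >])%:R else 0)))).
  apply: (@avg_le _ _ _ (m :: ms)) => l sl; have := supp_size sl; case: l sl => [|p l] // sl _.
  case: asboolP => [Hwin|_]; last by rewrite addr_ge0 // sumr_ge0.
  have c : chain origin ((pre ++ [:: p]) ++ l).
    by rewrite -catA; apply/chain_cat; split=> //; exact: (supp_chain r0 lpre sl).
  have [eqs|hit1] : map (path_map w sigma ((pre ++ [:: p]) ++ l)) qs =
        map (path_map w sigma (pre ++ [:: p])) qs \/
      1 <= \sum_(x <- qs) (`[< hits rho (val x ord0) (p :: l) >])%:R :> R.
    elim: (qs) => [|x s [IHs|IHs]]; first by left.
      case: (pselect (hits rho (val x ord0) (p :: l))) => Hx.
        by right; rewrite big_cons (asboolT Hx) lerDl sumr_ge0.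
      left; rewrite /= IHs; congr (_ :: _); apply: path_map_local => //.
      by rewrite last_cat.
    by right; rewrite big_cons (le_trans IHs) // lerDr.
    have [Hfix Hcount] := Hwin; rewrite /= -cat_rcons -cats1 eqs in Hfix Hcount.
    rewrite [X in _ <= _ + X](_ : _ = 1); first by rewrite lerDr sumr_ge0.
    rewrite asboolT //; split=> //; exact: leq_trans (leq_addl _ _) Hcount.
  by apply: le_trans hit1 _; rewrite lerDl.
rewrite avgD [game_bound _ _]/=; apply: lerD.
  rewrite avg_sum //; apply: (@le_trans _ _ (\sum_(x <- qs)
      (hit_cst R d (size ms) * (hgt ms)%:R / ((m * hgt ms) ^ d)%:R))).
    by apply: ler_sum => x _; exact: avg_hits.
  rewrite big_const_seq count_predT iter_addr_0 -[_ *+ size qs]mulr_natl.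
  case: ms sz' {IH ms0 sz lpre bnd ms0'} => // m2 ms _.
  by rewrite ler_wpM2r ?ler_nat // !mulr_ge0 ?invr_ge0 ?hit_cst_ge0.
apply: avg_cons_le => // o; apply: IH => //.
- apply/chain_cat; split=> //=; split=> // i; apply: le_trans (lpre i) _.
  exact: (sub_point_ge r0).
- by move=> i; rewrite last_cat /=; exact: (sub_point_le r0).
- move=> i; apply: le_trans (bnd i); rewrite ler_wpM2l ?(ltW r0) // ler_nat.
  exact: sub_corner_le.
Qed.

End Game.

(** * From random maps to randomized algorithms *)

Section Yao.
Variables (R : realType) (d : nat) (rho : R).
Notation vec := ('I_d -> R).
Notation pt := ('I_d -> nat).

(** [avg] is a finite nonnegative combination, so it commutes with the integral over the coins. The
    hypotheses are asked on the support only, where the maps are known to be Lipschitz. *)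
Lemma integral_avg (dT : measure_display) (T : measurableType dT) (P : probability T R)
    ms (b : pt) (f : seq vec -> T -> R) (I : seq vec -> R) :
  (forall l, supp rho ms b l -> [/\ measurable_fun setT (f l), forall t, 0 <= f l t &
     (\int[P]_t (f l t)%:E = (I l)%:E)%E]) ->
  let g t := avg rho ms b (fun l => f l t) in
  [/\ measurable_fun setT g, forall t, 0 <= g t &
      (\int[P]_t (g t)%:E = (avg rho ms b I)%:E)%E].
Proof.
elim: ms b f I => [|m ms IH] b f I H; first exact: H.
have {}IH (o : {ffun 'I_d -> 'I_m * 'I_(hgt ms)}) := IH (sub_corner b o)
   (fun l => f (sub_point rho b o :: l)) (fun l => I (sub_point rho b o :: l))
   (fun l sl => H (sub_point rho b o :: l) (ex_intro _ o (conj erefl sl))).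
set K : R := ((m * hgt ms) ^ d)%:R^-1; have K0 : 0 <= K by rewrite invr_ge0.
split=> [|t|].
- apply: measurable_realfun.measurable_funM; first exact: measurable_cst.
  by apply: measurable_sum => o; case: (IH o).
- by rewrite avg_cons mulr_ge0 // sumr_ge0 // => o _; case: (IH o) => _ /(_ t).
rewrite avg_cons -/K; under eq_integral do rewrite avg_cons -/K EFinM -sumEFin.
rewrite ge0_integralZl_EFin //; last 2 first.
- by move=> t _; apply: sume_ge0 => o _; rewrite lee_fin; case: (IH o) => _ /(_ t).
- apply: emeasurable_sum => o; apply/measurable_realfun.measurable_EFinP; by case: (IH o).
rewrite ge0_integral_sum //; last 2 first.
- by move=> o; apply/measurable_realfun.measurable_EFinP; case: (IH o).
- by move=> o t _; rewrite lee_fin; case: (IH o) => _ /(_ t).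
rewrite EFinM -sumEFin; congr (_ * _)%E; apply: eq_bigr => o _.
by case: (IH o).
Qed.

End Yao.

Section LowerBound.
Variables (R : realType) (d k : nat) (L w sigma eps : R).
Notation origin := (fun=> @GRing.zero R).
Notation dR := (@GRing.natmul R 1 d).
Notation rho := ((2 * dR + 4) * w).
Hypotheses (d0 : (0 < d)%N) (w0 : 0 < w) (sigma0 : 0 < sigma).
Hypotheses (sigma1 : sigma <= 1) (eps_lt : 0 < eps < 1 / 2).
Hypothesis (wsigma : w * sigma = 2 * dR * eps).
Hypothesis (sigmaL : sigma * (dR + 1) <= L - 1).

(* Yao's principle: the game is played against the uniform distribution on the
   instances, and runs with more than [T] queries are discarded by Markov's
   inequality. *)
Lemma rand_cost_lower (A : rand_algorithm R (cube R d) k) ms (T : nat) (c : R) :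
  all (leq 1) ms -> size ms = k.+1 -> rho * (2 * hgt ms)%:R <= 1 / 2 -> (0 < T)%N ->
  rand_solves L eps A -> (rand_cost L A <= c%:E)%E ->
  2 / 3 <= game_bound R d T ms + c / T%:R.
Proof.
move=> ms0 sz bnd T0 sol cost; have r0 := rho_gt0 d w0.
pose b : 'I_d -> nat := fun=> 0%N.
pose F (l : seq ('I_d -> R)) := path_map w sigma l.
pose P := coin_law A.
have Flip l : supp rho ms b l -> lipschitz_maps L (F l).
  move=> sl; apply: (path_map_lipschitz w sigma0 _ sigmaL).
  apply: (supp_chain r0 _ sl) => i; rewrite mulr_ge0 // ?(ltW r0) //.
pose succ l t := approx_fixed_point eps (F l) (output (F l) (strategy (r := A) t)).
pose cnt l t := (query_count (F l) (strategy (r := A) t))%:R : R.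
have H1 l : supp rho ms b l -> [/\ measurable_fun setT (fun t => (`[< succ l t >])%:R : R),
    forall t, 0 <= (`[< succ l t >])%:R :> R &
    (\int[P]_t ((`[< succ l t >])%:R : R)%:E = (fine (P [set t | succ l t]))%:E)%E].
  move=> sl; have [mS _ _] := sol _ (Flip l sl).
  have E : (fun t => (`[< succ l t >])%:R : R) = \1_[set t | succ l t].
    apply/funext => t; rewrite indicE.
    have -> // : (t \in [set t | succ l t]) = `[< succ l t >].
    by apply/idP/asboolP => [/set_mem|/mem_set].
  split=> //; first by rewrite E; exact: measurable_realfun.measurable_indic.
  under eq_integral do rewrite -[_%:R]/((fun t => (`[< succ l t >])%:R : R) _) E.
  rewrite integral_indic // setIT fineK //; exact: fin_num_measure.
have H2 l : supp rho ms b l -> [/\ measurable_fun setT (cnt l), forall t, 0 <= cnt l t &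
    (\int[P]_t (cnt l t)%:E = (fine (\int[P]_t (cnt l t)%:E))%:E)%E] /\
    fine (\int[P]_t (cnt l t)%:E)%E <= c.
  move=> sl; have [_ mC _] := sol _ (Flip l sl).
  have le : (\int[P]_t (cnt l t)%:E <= c%:E)%E.
    apply: le_trans cost; apply: ereal_sup_ubound; exists (F l); first exact: Flip.
    by rewrite unlock.
  have ge : (0 <= \int[P]_t (cnt l t)%:E)%E by apply: integral_ge0 => t _; rewrite lee_fin.
  have fin : (\int[P]_t (cnt l t)%:E)%E \is a fin_num.
    by rewrite ge0_fin_numE //; apply: le_lt_trans le _; rewrite ltry.
  by split; [split=> //; rewrite fineK|rewrite -lee_fin fineK].
have [mPhi Phi0 iPhi] := integral_avg H1.
have [mPsi Psi0 iPsi] := integral_avg (fun l sl => (H2 l sl).1).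
move: mPhi Phi0 iPhi mPsi Psi0 iPsi.
set Phi := fun t => avg _ _ _ (fun l => (`[< succ l t >])%:R).
set Psi := fun t => avg _ _ _ (fun l => cnt l t).
move=> mPhi Phi0 iPhi mPsi Psi0 iPsi.
have Tr : 0 < T%:R :> R by rewrite ltr0n.
have gb0 := game_bound_ge0 R d T ms.
(* A successful run either wins within [T] queries or has a query count which, divided by [T], is at
   least 1. *)
have point t : Phi t <= game_bound R d T ms + T%:R^-1 * Psi t.
  have := avg_wins d0 w0 sigma0 sigma1 eps_lt wsigma T (strategy (r := A) t) (b := b) (pre := [::]) ms0 sz.
  move=> /(_ _ _ _) H; apply: (@le_trans _ _ (avg rho ms b (fun l =>
    (`[< wins eps T (strategy (r := A) t) (F l) >])%:R + T%:R^-1 * cnt l t))).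
    apply: avg_le => l sl; case: asboolP => // Hs; last first.
      by rewrite addr_ge0 // mulr_ge0 // invr_ge0.
    case: (leqP (query_count (F l) (strategy (r := A) t)) T) => Hc.
      by rewrite asboolT ?lerDl ?mulr_ge0 ?invr_ge0.
    have le1 : 1 <= T%:R^-1 * cnt l t.
      by rewrite ler_pdivlMl // mulr1 /cnt ler_nat ltnW.
    by apply: le_trans le1 _; rewrite lerDr.
  rewrite avgD avgM; apply: lerD => //; apply: H => // i.
  by rewrite mulr_ge0 // ltW.
have lo : 2 / 3 <= avg rho ms b (fun l => fine (P [set t | succ l t])).
  rewrite -[leLHS](avg_cst rho b (2/3) ms0); apply: avg_le => l sl.
  have [mS _ pS] := sol _ (Flip l sl).
  by rewrite -lee_fin fineK //; exact: fin_num_measure.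
have hi : avg rho ms b (fun l => fine (\int[P]_t (cnt l t)%:E)%E) <= c.
  rewrite -[leRHS](avg_cst rho b c ms0); apply: avg_le => l sl; exact: (H2 l sl).2.
have : (\int[P]_t (Phi t)%:E <= \int[P]_t (game_bound R d T ms + T%:R^-1 * Psi t)%:E)%E.
  apply: ge0_le_integral => //.
  - by move=> t _; rewrite lee_fin; exact: Phi0.
  - exact/measurable_realfun.measurable_EFinP.
  - apply/measurable_realfun.measurable_EFinP;
    apply: measurable_realfun.measurable_funD; first exact: measurable_cst.
    by apply: measurable_realfun.measurable_funM => //; exact: measurable_cst.
  - by move=> t _; rewrite lee_fin; exact: point.
under [X in (_ <= X)%E]eq_integral do rewrite EFinD EFinM.
rewrite ge0_integralD //; last 2 first.
- by move=> t _; rewrite -EFinM lee_fin mulr_ge0 ?invr_ge0 //; exact: Psi0.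
- under eq_fun do rewrite -EFinM.
  apply/measurable_realfun.measurable_EFinP.
  apply: measurable_realfun.measurable_funM => //; exact: measurable_cst.
rewrite ge0_integralZl_EFin ?invr_ge0 //; last 2 first.
- by move=> t _; rewrite lee_fin; exact: Psi0.
- exact/measurable_realfun.measurable_EFinP.
rewrite integral_cst // [X in (_ * X + _)%E](_ : _ = 1%E); last exact: (@probability_setT _ _ _ P).
rewrite mule1 iPhi iPsi -EFinM -EFinD lee_fin => H.
apply: le_trans lo (le_trans H _); rewrite lerD2l mulrC ler_wpM2r ?invr_ge0 //.
Qed.

End LowerBound.

(** * Choice of the box sizes *)

Section Exponents.
Variables (R : realType) (d k : nat).
Hypotheses (hd : (2 <= d)%N) (hk : (1 <= k)%N).
Notation dR := (@GRing.natmul R 1 d).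
Implicit Types (n : R) (t j : nat).

Definition alpha : R := (dR ^+ k.+1 - dR ^+ k) / (dR ^+ k - 1).

(* After [t] rounds the boxes have side about [n `^ expo t]; these exponents
   equalize the costs [side_t ^ d / side_(t + 1)] of all rounds. *)
Definition expo t : R := (dR ^+ k - dR ^+ t) / (dR ^+ k - 1).

Lemma dk_gt1 : 0 < dR ^+ k - 1.
Proof. by rewrite subr_gt0 exprn_egt1 // ?ltr1n // -lt0n. Qed.

Lemma expo0 : expo 0 = 1.
Proof. by rewrite /expo expr0 divff // gt_eqF // dk_gt1. Qed.

Lemma expok : expo k = 0.
Proof. by rewrite /expo subrr mul0r. Qed.

Lemma expo_step t : dR * expo t = alpha + expo t.+1.
Proof. by have := lt0r_neq0 dk_gt1 => ne; rewrite /expo /alpha !exprS; field. Qed.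

Lemma expo_le t : expo t.+1 <= expo t.
Proof.
rewrite ler_pM2r ?invr_gt0 ?dk_gt1 // lerD2l lerN2 exprS ler_peMl ?exprn_ge0 //.
by rewrite ler1n (leq_trans _ hd).
Qed.

Lemma pow_step n t : 0 < n -> (n `^ expo t) ^+ d = n `^ alpha * n `^ expo t.+1.
Proof.
move=> n0; rewrite -powR_mulrn ?powR_ge0 // -powRrM mulrC expo_step powRD //.
by rewrite (gt_eqF n0) implybT.
Qed.

(** Rounding up keeps the product of all ratios at least [n]; as the exact ratio is at least 1, this
    costs at most a factor 2 per round. *)
Definition ratio n t : nat := (Num.truncn (n `^ (expo t - expo t.+1))).+1.
Definition ratios n t j : seq nat := [seq ratio n s | s <- iota t j].
Definition nprod (s : seq nat) : nat := (\prod_(r <- s) r)%N.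

Lemma ratio_bounds n t : 1 <= n ->
  n `^ (expo t - expo t.+1) <= (ratio n t)%:R <= 2 * n `^ (expo t - expo t.+1).
Proof.
move=> n1; have p1 : 1 <= n `^ (expo t - expo t.+1).
  by rewrite -(powRr0 n) ler_powR // subr_ge0 expo_le.
have /andP[h1 h2] := truncn_itv (le_trans ler01 p1).
rewrite /ratio (ltW h2) /= -natr1; lra.
Qed.

Lemma ratios_gt0 n t j : all (leq 1) (ratios n t j).
Proof. by apply/allP => r /mapP[s _ ->]. Qed.

Lemma nprod_cons r s : nprod (r :: s) = (r * nprod s)%N.
Proof. by rewrite /nprod big_cons. Qed.

Lemma nprod_gt0 s : all (leq 1) s -> (0 < nprod s)%N.
Proof. by elim: s => [|r s IH] /=; rewrite /nprod ?big_nil // big_cons muln_gt0 => /andP[-> /IH]. Qed.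

Lemma nprod_ratios n t j : 1 <= n -> (t + j)%N = k ->
  n `^ expo t <= (nprod (ratios n t j))%:R <= 2 ^+ j * n `^ expo t.
Proof.
move=> n1; have n0 : 0 < n by apply: lt_le_trans n1.
elim: j t => [|j IH] t.
  by rewrite addn0 => ->; rewrite /nprod big_nil expok powRr0 expr0 mulr1 lexx.
rewrite addnS -addSn => /IH/andP[h1 h2]; have /andP[h3 h4] := ratio_bounds t n1.
have E : n `^ expo t = n `^ (expo t - expo t.+1) * n `^ expo t.+1.
  by rewrite -powRD ?subrK // (gt_eqF n0) implybT.
rewrite nprod_cons natrM E; apply/andP; split.
  by apply: ler_pM => //; exact: powR_ge0.
apply: le_trans (ler_pM _ _ h4 h2) _ => //.
by rewrite le_eqVlt exprS; apply/orP; left; apply/eqP; ring.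
Qed.

Lemma two_le_pow j : (j <= k)%N -> (2 ^+ j : R) <= 2 ^+ k.
Proof. by move=> jk; rewrite ler_eXn2l // ltr1n. Qed.

(** The estimate side ^ d / l for the number of wall points, multiplied by [l] to stay in [nat]. *)
Lemma round_cost_le r l : (0 < r)%N -> (0 < l)%N ->
  (round_cost d r l * l <= d * 2 ^ d * (r * l) ^ d)%N.
Proof.
move=> r0 l0; rewrite /round_cost -!mulnA leq_mul2l; apply/orP; right.
rewrite -(prednK (ltnW hd)) /= !expnS.
apply: (@leq_trans ((2 * r) * ((2 * (r * l)) ^ d.-1 * l))%N).
  apply: leq_mul; first lia.
  apply: leq_mul => //; rewrite leq_exp2r -?subn1 ?subn_gt0 //.
  by rewrite mul2n -addnn -[ltnLHS]addn0 ltn_add2l muln_gt0 r0.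
by rewrite expnMn; lia.
Qed.

Definition upper_cst : R := k%:R * (d%:R * 2 ^+ d * (2 ^+ k) ^+ d).

Lemma total_cost_le n t j : 1 <= n -> (t + j)%N = k ->
  (total_cost d (ratios n t j))%:R <= j%:R * (d%:R * 2 ^+ d * (2 ^+ k) ^+ d) * n `^ alpha.
Proof.
move=> n1; have n0 : 0 < n by apply: lt_le_trans n1.
elim: j t => [|j IH] t; first by rewrite !mul0r.
move=> tj; have tj' : (t.+1 + j)%N = k by rewrite addSn -addnS.
have /andP[a1 a2] := nprod_ratios n1 tj; have /andP[b1 b2] := nprod_ratios n1 tj'.
have := IH _ tj'; rewrite /= -/(ratios n t.+1 j) natrD -[j.+1%:R]natr1.
set r := ratio n t; set s := ratios n t.+1 j; set X := n `^ alpha => {}IH.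
have -> : (j%:R + 1) * (d%:R * 2 ^+ d * (2 ^+ k) ^+ d) * X =
   d%:R * 2 ^+ d * (2 ^+ k) ^+ d * X + j%:R * (d%:R * 2 ^+ d * (2 ^+ k) ^+ d) * X by ring.
apply: lerD => //.
have s0 : (0 < nprod s)%N by apply: nprod_gt0; exact: ratios_gt0.
have sr0 : 0 < (nprod s)%:R :> R by rewrite ltr0n.
rewrite -(ler_pM2r sr0) -natrM -/(nprod s).
apply: (@le_trans _ _ (d * 2 ^ d * (r * nprod s) ^ d)%:R).
  by rewrite ler_nat round_cost_le.
rewrite !natrM !natrX -!mulrA; apply: ler_wpM2l => //; apply: ler_wpM2l; first exact: exprn_ge0.
apply: (@le_trans _ _ ((2 ^+ k * n `^ expo t) ^+ d)).
  rewrite lerXn2r ?nnegrE ?mulr_ge0 ?exprn_ge0 ?powR_ge0 //.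
  rewrite -nprod_cons; apply: le_trans a2 _; rewrite ler_wpM2r ?powR_ge0 // two_le_pow //.
  by rewrite -tj leq_addl.
rewrite exprMn pow_step // ler_wpM2l ?exprn_ge0 // ler_wpM2l ?powR_ge0 //.
Qed.

Lemma hgt_rcons s M : hgt (s ++ [:: M]) = (2 ^ (size s).+1 * M * nprod s)%N.
Proof.
elim: s => [|r s IH] /=; first by rewrite /nprod big_nil !muln1.
by rewrite IH nprod_cons [(2 ^ (size s).+2)%N]expnS; lia.
Qed.

(** The last level is for the output, which finds the last point with probability at most (9 / 36) ^
    d <= 1 / 4. *)
Definition levels n t j : seq nat := ratios n t j ++ [:: 36].

Lemma levels_gt0 n t j : all (leq 1) (levels n t j).
Proof. by rewrite all_cat ratios_gt0. Qed.

Definition hit_sum : R := \sum_(i < k.+1) hit_cst R d i.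

Lemma hit_cst_le i : (i <= k)%N -> hit_cst R d i <= hit_sum.
Proof.
move=> ik; have ik' : (i < k.+1)%N by [].
rewrite /hit_sum (bigD1 (Ordinal ik')) //= lerDl sumr_ge0 // => l _; exact: hit_cst_ge0.
Qed.

(** One power of 2 comes from the halving of boxes in [hgt], the other from the rounding in
    [ratios]. *)
Definition loss_cst : R := hit_sum * (36 * 2 ^+ k * 2 ^+ k).

Lemma game_bound_le (T : nat) n t j : 1 <= n -> (t + j)%N = k ->
  game_bound R d T (levels n t j) <= j%:R * (T%:R * loss_cst / n `^ alpha) + 1 / 4.
Proof.
move=> n1; have n0 : 0 < n by apply: lt_le_trans n1.
have X0 := powR_gt0 alpha n0.
elim: j t => [|j IH] t.
  move=> _; rewrite mul0r add0r /= mul1r addr0 mulr1 muln1 natrX -exprVn -exprMn.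
  have -> : 9 * 36%:R^-1 = 1 / 4 :> R by field.
  have q0 : 0 <= 1 / 4 :> R by lra.
  have q1 : 1 / 4 <= 1 :> R by lra.
  by rewrite -[leRHS]expr1 ler_wiXn2l // ltnW.
move=> tj; have tj' : (t.+1 + j)%N = k by rewrite addSn -addnS.
have /andP[a1 a2] := nprod_ratios n1 tj; have /andP[b1 b2] := nprod_ratios n1 tj'.
have -> : levels n t j.+1 = ratio n t :: levels n t.+1 j by [].
have := IH _ tj'; have := hgt_rcons (ratios n t.+1 j) 36.
have : size (levels n t.+1 j) = j.+1 by rewrite size_cat size_map size_iota addn1.
rewrite size_map size_iota -/(levels n t.+1 j) => szl hgtl {}IH.
have -> : game_bound R d T (ratio n t :: levels n t.+1 j) =
  T%:R * (hit_cst R d (size (levels n t.+1 j)) * (hgt (levels n t.+1 j))%:R /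
   ((ratio n t * hgt (levels n t.+1 j)) ^ d)%:R) + game_bound R d T (levels n t.+1 j).
  by move: szl; case: (levels n t.+1 j).
rewrite -[j.+1%:R]natr1 mulrDl mul1r [_ + T%:R * loss_cst / _]addrC -addrA; apply: lerD => //.
rewrite -!mulrA; apply: ler_wpM2l => //; rewrite /loss_cst.
have -> : 36 * (2 ^+ k * (2 ^+ k / n `^ alpha)) = 36 * 2 ^+ k * 2 ^+ k / n `^ alpha :> R.
  by rewrite !mulrA.
apply: ler_pM; [exact: hit_cst_ge0|by rewrite mulr_ge0 ?invr_ge0| |].
  by apply: hit_cst_le; rewrite szl -tj leq_addl.
set s := ratios n t.+1 j in b1 b2 hgtl *; set r := ratio n t in a1 a2 *.
have s0 : (0 < nprod s)%N by apply: nprod_gt0; exact: ratios_gt0.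
rewrite hgtl; set h := (_ * nprod s)%N.
have hX : ((r * nprod s) ^ d <= (r * h) ^ d)%N.
  by rewrite leq_exp2r ?(ltnW hd) // leq_mul2l /h leq_pmull ?orbT // !muln_gt0 expn_gt0.
have rs0 : (0 < r * nprod s)%N by rewrite muln_gt0 s0.
rewrite ler_pdivrMr; last by rewrite ltr0n (leq_trans _ hX) // expn_gt0 rs0.
apply: (@le_trans _ _ (36 * 2 ^+ k * 2 ^+ k / n `^ alpha * ((r * nprod s) ^ d)%:R)); last first.
  by rewrite ler_wpM2l ?ler_nat // !mulr_ge0 ?invr_ge0 ?exprn_ge0 ?powR_ge0.
apply: (@le_trans _ _ (36 * 2 ^+ k * 2 ^+ k / n `^ alpha * (n `^ expo t) ^+ d)); last first.
  rewrite ler_wpM2l ?mulr_ge0 ?invr_ge0 ?exprn_ge0 ?powR_ge0 //.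
  by rewrite natrX lerXn2r ?nnegrE ?powR_ge0 // -nprod_cons.
rewrite pow_step // [X in _ <= X](_ : _ = 36 * 2 ^+ k * (2 ^+ k * n `^ expo t.+1)); last first.
  by field; rewrite gt_eqF.
rewrite /h !natrM natrX [2%:R ^+ _ * 36%:R]mulrC; apply: ler_pM => //.
- by rewrite ler_wpM2l // two_le_pow // -tj addnS ltnS leq_addl.
- by apply: le_trans b2 _; rewrite ler_wpM2r ?powR_ge0 // two_le_pow // -tj' leq_addl.
Qed.

Lemma hgt_levels_le n : 1 <= n ->
  (hgt (levels n 0 k))%:R <= 2 * 36 * 2 ^+ k * 2 ^+ k * n.
Proof.
move=> n1; rewrite hgt_rcons size_map size_iota !natrM natrX exprS.
have /andP[_] := nprod_ratios n1 (add0n k); rewrite expo0 powRr1; last by apply: le_trans n1.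
move=> H; rewrite -!mulrA; apply: ler_wpM2l => //.
rewrite [leLHS](_ : _ = 36 * (2 ^+ k * (nprod (ratios n 0 k))%:R)); last by ring.
by rewrite !ler_wpM2l ?exprn_ge0.
Qed.

End Exponents.

(** * Bounds on the two complexities and their asymptotics *)

Lemma det_complexity_le (R : realType) (d : nat) (L eps : R) (rs : seq nat) :
  (0 < d)%N -> 0 <= L -> all (leq 1) rs -> L + 1 <= eps * (nprod rs)%:R ->
  (det_query_complexity d (size rs) L eps <= ((total_cost d rs)%:R)%:E)%E.
Proof.
move=> d0 L0 rs0 Le; have N0 := nprod_gt0 rs0.
pose A := @grid_algorithm R d (nprod rs) N0 rs (fun=> 0%N).
apply: (@le_trans _ _ (det_cost L A)).
  apply: ereal_inf_lbound; exists A => //.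
  exact: grid_algorithm_solves.
apply: ge_ereal_sup => _ [F FL <-].
by rewrite lee_fin ler_nat grid_algorithm_count.
Qed.

(** A one-point coin space suffices. Through this comparison the theorem reduces to a deterministic
    upper bound and a randomized lower bound. *)
Lemma rand_complexity_le_det (R : realType) (d k : nat) (L eps : R) :
  (rand_query_complexity d k L eps <= det_query_complexity d k L eps)%E.
Proof.
apply: le_ereal_inf_tmp => _ [A solA ->].
pose B : rand_algorithm R (cube R d) k :=
  @RandAlgorithm R (cube R d) k _ unit (\d_tt : probability unit R) (fun=> A).
have solB : rand_solves L eps B.
  move=> F FL /=; have E : [set _ : unit | approx_fixed_point eps F (output F A)] = setT.
    by apply/seteqP; split=> // t _; exact: solA.
  rewrite E; split; [exact: measurableT|exact: measurable_cst|].
  by rewrite probability_setT lee_fin; lra.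
apply: (@le_trans _ _ (rand_cost L B)); first by apply: ereal_inf_lbound; exists B.
apply: ge_ereal_sup => _ [F FL <-]; rewrite [X in (X <= _)%E]expectation_cst.
by apply: ereal_sup_ubound; exists F.
Qed.

Section Bounds.
Variables (R : realType) (d k : nat) (L : R).
Hypotheses (hd : (2 <= d)%N) (hk : (1 <= k)%N) (hL : 1 < L).
Notation dR := (@GRing.natmul R 1 d).
Notation al := (alpha R d k).

Lemma det_complexity_upper eps n : 1 <= n -> L + 1 <= eps * n -> 0 < eps ->
  (det_query_complexity d k L eps <= (upper_cst R d k * n `^ al)%:E)%E.
Proof.
move=> n1 Le e0; have L1 := hL.
have n0 : 0 < n by apply: lt_le_trans n1.
pose rs := ratios d k n 0 k.
have sz : size rs = k by rewrite size_map size_iota.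
have /andP[h1 _] := nprod_ratios hd hk n1 (add0n k).
have Le' : L + 1 <= eps * (nprod rs)%:R.
  apply: le_trans Le _; rewrite ler_wpM2l ?(ltW e0) //.
  by move: h1; rewrite expo0 // powRr1 // ltW.
have L0 : 0 <= L by lra.
have := det_complexity_le (ltnW hd) L0 (ratios_gt0 d k n 0 k) Le'.
rewrite sz => H; apply: le_trans H _; rewrite lee_fin.
exact: total_cost_le.
Qed.

(** [expo_step] at 0 gives alpha = d - [expo] 1. The bound makes n ^ alpha dominate n, so that at
    least one query is allowed for small eps. *)
Lemma alpha_ge1 : 1 <= al.
Proof.
have := expo_step R hd hk 0; rewrite expo0 // mulr1.
have := expo_le R hd hk 0; rewrite expo0 //.
have : 2%:R <= dR by rewrite ler_nat.
lra.
Qed.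

(** The largest step that [path_map_lipschitz] allows, capped at 1 for [path_map_fixed]. *)
Definition sigma : R := Num.min 1 ((L - 1) / (dR + 1)).

Lemma sigma_gt0 : 0 < sigma.
Proof. by rewrite lt_min ltr01 divr_gt0 // ?subr_gt0 // ltr_wpDl. Qed.

(* [2 * hgt (levels n 0 k)] grid steps of length [(2 d + 4) w] with
   [w = 2 d eps / sigma] must fit into [1 / 2] when [n = fit_cst / eps]. *)
Definition fit_cst : R :=
  (4 * (2 * 36 * 2 ^+ k * 2 ^+ k) * ((2 * dR + 4) * (2 * dR / sigma)))^-1.

(** With T <= [query_cst] * n ^ alpha the rounds contribute at most 1 / 4 to [game_bound]; the
    summand 1 keeps the inverse positive. *)
Definition query_cst : R := (4 * (k%:R * loss_cst R d k + 1))^-1.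

Lemma dR_ge2 : 2 <= dR.
Proof. by rewrite -[2]/(2%:R) ler_nat. Qed.

Lemma fit_cst_gt0 : 0 < fit_cst.
Proof.
have d2 := dR_ge2; have s0 := sigma_gt0.
rewrite invr_gt0 !mulr_gt0 ?invr_gt0 ?exprn_gt0 //; lra.
Qed.

Lemma loss_cst_ge0 : 0 <= loss_cst R d k.
Proof.
rewrite !mulr_ge0 ?exprn_ge0 // sumr_ge0 // => i _; exact: hit_cst_ge0.
Qed.

Lemma query_cst_gt0 : 0 < query_cst.
Proof.
have l0 := loss_cst_ge0; have kl : 0 <= k%:R * loss_cst R d k by rewrite mulr_ge0.
by rewrite invr_gt0; lra.
Qed.

(** With a cost of at most T / 12, the success probability would be at most 1 / 4 for the rounds, 1
    / 4 for the output and 1 / 12 by Markov, in all 7 / 12 < 2 / 3. The remaining factor 2 in 24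
    absorbs the rounding of [T], as T >= 1. *)
Lemma rand_complexity_lower eps : 0 < eps < 1 / 2 -> 1 <= fit_cst / eps ->
  1 <= query_cst * (fit_cst / eps) `^ al ->
  ((query_cst * (fit_cst / eps) `^ al / 24)%:E <= rand_query_complexity d k L eps)%E.
Proof.
move=> eh n1; have /andP[e0 _] := eh; set n := fit_cst / eps in n1 *; set X := n `^ al => qX.
have n0 : 0 < n by apply: lt_le_trans n1.
have X0 : 0 < X by exact: powR_gt0.
have q0 := query_cst_gt0; have s0 := sigma_gt0; have d2 := dR_ge2; have l0 := loss_cst_ge0.
pose T := Num.truncn (query_cst * X).
have /andP[T1 T2] : T%:R <= query_cst * X < T.+1%:R by apply: truncn_itv; rewrite mulr_ge0 // ltW.
have T0 : (0 < T)%N by rewrite truncn_ge_nat // mulr_ge0 // ltW.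
have Tr : 1 <= T%:R :> R by rewrite ler1n.
have T3 : query_cst * X / 24 <= T%:R / 12 by rewrite -natr1 in T2; lra.
apply: (@le_trans _ _ (T%:R / 12)%:E); first by rewrite lee_fin.
apply: le_ereal_inf_tmp => _ [A solA ->]; rewrite leNgt; apply/negP => /ltW cost.
pose w := 2 * dR * eps / sigma.
have w0 : 0 < w by rewrite !mulr_gt0 ?invr_gt0 //; lra.
have ws : w * sigma = 2 * dR * eps by rewrite /w divfK // gt_eqF.
have sL : sigma * (dR + 1) <= L - 1.
  rewrite -ler_pdivlMr; last by lra.
  by rewrite ge_min lexx orbT.
have s1 : sigma <= 1 by rewrite ge_min lexx.
have fits : (2 * dR + 4) * w * (2 * hgt (levels d k n 0 k))%:R <= 1 / 2.
  have H := hgt_levels_le hd hk n1; rewrite natrM.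
  apply: (@le_trans _ _ ((2 * dR + 4) * w * (2 * (2 * 36 * 2 ^+ k * 2 ^+ k * n)))).
    have c0 : 0 <= (2 * dR + 4) * w by apply: mulr_ge0; [lra|exact: ltW].
    by apply: ler_wpM2l => //; apply: ler_wpM2l.
  rewrite le_eqVlt; apply/orP; left; apply/eqP; rewrite /n /fit_cst /w; field.
  rewrite !gt_eqF ?exprn_gt0 //; lra.
have sz : size (levels d k n 0 k) = k.+1 by rewrite size_cat size_map size_iota addn1.
have := rand_cost_lower (ltnW hd) w0 s0 s1 eh ws sL (levels_gt0 d k n 0 k) sz fits T0 solA cost.
have gb := game_bound_le hd hk T n1 (add0n k).
have small : k%:R * (T%:R * loss_cst R d k / X) <= 1 / 4.
  rewrite mulrA ler_pdivrMr // mulrCA.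
  have kl : 0 <= k%:R * loss_cst R d k by rewrite mulr_ge0.
  apply: (@le_trans _ _ (query_cst * X * (k%:R * loss_cst R d k))).
    by rewrite ler_wpM2r.
  rewrite mulrAC ler_wpM2r ?(ltW X0) // /query_cst ler_pdivrMl; lra.
have -> : T%:R / 12 / T%:R = 1 / 12 :> R by field; lra.
rewrite -/X in gb; lra.
Qed.

End Bounds.

Lemma complexity_ThetaI (R : realType) (Q : R -> \bar R) (g : R -> R) (lo up : R) :
  0 < lo -> 0 < up -> (forall eps, 0 < eps -> Q eps \is a fin_num) ->
  (\forall eps \near 0^'+, 0 <= g eps /\ ((lo * g eps)%:E <= Q eps <= (up * g eps)%:E)%E) ->
  complexity_Theta Q g.
Proof.
move=> lo0 up0 fin H; split=> //; rewrite eqThetaE qualifE; apply/asboolP.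
exists (lo, up); first by rewrite /= lo0.
near=> eps; have e0 : 0 < eps by near: eps; exact: nbhs_right_gt.
have [g0 /andP[h1 h2]] : 0 <= g eps /\ ((lo * g eps)%:E <= Q eps <= (up * g eps)%:E)%E.
  by near: eps.
rewrite /= (ger0_norm g0); have f := fin _ e0.
rewrite -(fineK f) !lee_fin in h1 h2.
by rewrite ger0_norm // (le_trans _ h1) // mulr_ge0 // ltW.
Unshelve. all: by end_near. Qed.

Theorem theorem3 (R : realType) (d k : nat) (L : R)
    (hd : (2 <= d)%N) (hk : (1 <= k)%N) (hL : 1 < L) :
  let g (eps : R) :=
    (1 / eps) `^ ((d%:R ^+ k.+1 - d%:R ^+ k) / (d%:R ^+ k - 1)) in
  complexity_Theta (fun eps => det_query_complexity d k L eps) g /\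
  complexity_Theta (fun eps => rand_query_complexity d k L eps) g.
Proof.
move=> g; have gE eps : g eps = (1 / eps) `^ alpha R d k by [].
have L1 : 0 < L + 1 by lra.
have rand_ge0 eps : (0 <= rand_query_complexity d k L eps)%E.
  apply: le_ereal_inf_tmp => _ [A _ ->].
  (* The identity shows that the cost is a supremum over a nonempty set. *)
  have idL : lipschitz_maps L (idfun : cube R d -> cube R d).
    by move=> x y; rewrite ler_peMl // ltW.
  apply: (@le_trans _ _ ('E_(coin_law A)[fun w =>
      (query_count (idfun : cube R d -> cube R d) (strategy (r := A) w))%:R])%E).
    by apply: expectation_ge0.
  by apply: ereal_sup_ubound; exists idfun.
have upper eps : 0 < eps -> exists2 c : R, 0 <= c & (det_query_complexity d k L eps <= c%:E)%E.
  (* The maximum with 1 covers large [eps], for which finiteness is claimed too. *)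
  move=> e0; pose n := Num.max 1 ((L + 1) / eps).
  have Le : L + 1 <= eps * n by rewrite -ler_pdivrMl // mulrC le_max lexx orbT.
  have n1 : 1 <= n by rewrite le_max lexx.
  exists (upper_cst R d k * n `^ alpha R d k); last exact: det_complexity_upper.
  by rewrite !mulr_ge0 ?exprn_ge0 ?powR_ge0.
have det_fin eps : 0 < eps -> det_query_complexity d k L eps \is a fin_num.
  move=> /upper[c _ Hc]; rewrite ge0_fin_numE.
    by apply: le_lt_trans Hc _; rewrite ltry.
  exact: le_trans (rand_complexity_le_det _ _ _ _).
have rand_fin eps : 0 < eps -> rand_query_complexity d k L eps \is a fin_num.
  move=> /upper[c _ Hc]; rewrite ge0_fin_numE //.
  by apply: le_lt_trans (rand_complexity_le_det _ _ _ _) (le_lt_trans Hc _); rewrite ltry.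
pose lo := query_cst R d k * (fit_cst d k L) `^ alpha R d k / 24.
pose up := upper_cst R d k * (L + 1) `^ alpha R d k.
have f0 := fit_cst_gt0 k hd hL; have q0 := query_cst_gt0 R d k.
have lo0 : 0 < lo by rewrite /lo divr_gt0 // mulr_gt0 // powR_gt0.
have up0 : 0 < up.
  by rewrite /up !mulr_gt0 ?powR_gt0 ?exprn_gt0 ?ltr0n // ltnW.
have main : \forall eps \near 0^'+, 0 <= g eps /\
   [/\ ((lo * g eps)%:E <= rand_query_complexity d k L eps)%E &
       (det_query_complexity d k L eps <= (up * g eps)%:E)%E].
  near=> eps; have e0 : 0 < eps by near: eps; exact: nbhs_right_gt.
  have e1 : eps < 1 / 2 by near: eps; apply: nbhs_right_lt; lra.
  have e2 : eps <= fit_cst d k L by near: eps; exact: nbhs_right_ltW.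
  (* This gives [query_cst] * n >= 1 for n = [fit_cst] / eps, and n ^ alpha >= n. *)
  have e3 : eps <= fit_cst d k L * query_cst R d k.
    by near: eps; apply: nbhs_right_ltW; rewrite mulr_gt0.
  split; first exact: powR_ge0.
  have n1 : 1 <= fit_cst d k L / eps by rewrite ler_pdivlMr // mul1r.
  split.
    have -> : lo * g eps = query_cst R d k * (fit_cst d k L / eps) `^ alpha R d k / 24.
      have -> : fit_cst d k L / eps = fit_cst d k L * (1 / eps) by rewrite mul1r.
      rewrite /lo gE powRM ?divr_ge0 ?(ltW f0) ?(ltW e0) //; ring.
    apply: rand_complexity_lower => //; first by rewrite e0.
    rewrite -ler_pdivrMl // mulr1; apply: (@le_trans _ _ (fit_cst d k L / eps)).
      by rewrite ler_pdivlMr // ler_pdivrMl // mulrC.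
    rewrite -[leLHS]powRr1; last by apply: le_trans n1.
    by apply: ler_powR => //; exact: alpha_ge1.
  have -> : up * g eps = upper_cst R d k * ((L + 1) / eps) `^ alpha R d k.
    have -> : (L + 1) / eps = (L + 1) * (1 / eps) by rewrite mul1r.
    by rewrite /up gE powRM ?divr_ge0 ?(ltW L1) ?(ltW e0) // mulrA.
  apply: det_complexity_upper => //.
    by rewrite ler_pdivlMr // mul1r; lra.
  by rewrite mulrC divfK // gt_eqF.
split; apply: (complexity_ThetaI lo0 up0) => //; apply: filterS main => eps [g0 [h1 h2]];
  split=> //; apply/andP; split=> //.
- exact: le_trans h1 (rand_complexity_le_det _ _ _ _).
- exact: le_trans (rand_complexity_le_det _ _ _ _) h2.
Unshelve. all: by end_near. Qed.
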